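(* Let $n>e$, $28 \ln^3 n \le r \le d/(28\ln n)$, $\lambda \le \frac{1}{8e^2}\min\{\frac{r}{\ln n}, n^{1/8}\} - 1$, and $1 + \frac{80 + 16\ln(\lambda+1)}{\ln n} \le c \le \ln n$. Let $P\subseteq\{0,1\}^d$ with $|P|=n$, and let an LSH data structure with parameters $r,c,\lambda$ be built on $P$ as described in the context. Let $t = 2e^2(\lambda+1)$. Suppose the point $z\in P$ given to the Simple adversarial walk (resp. the Fast adversarial walk) is at Hamming distance at least $2cr$ from every other point of $P$. Then, with probability at least $1/4 - 1/n$ (over the randomness of the LSH construction and of the algorithm), the algorithm finds (returns) a point $q$ with $\mathrm{dist}(q,z)\le r$ such that $\textsc{QueryLSH}(q)$ returns no point. The Simple adversarial walk uses at most $O(cr\cdot\lambda)$ queries to the LSH data structure, and the Fast adversarial walk uses at most $O(\log(cr)\cdot\lambda)$ queries.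
   Context: Hamming space $\{0,1\}^d$ with $\mathrm{dist}(p,q)=\sum_{i=1}^d|p_i-q_i|$. LSH construction: given $P\subseteq\{0,1\}^d$ with $|P|=n$ and parameters $r$, $c>1$, $\lambda>0$, set $p_1=1-r/d$, $p_2=1-cr/d$, $\rho=\frac{\log(1/p_1)}{\log(1/p_2)}$, $\ell=n^\rho$, $k=\lceil \log_{1/p_2} n\rceil$, $L=\lceil \lambda\ell\rceil$. The data structure stores a multiset $G$ of $L$ hash functions, each independently of the form $g(x)=(x_{i_1},\dots,x_{i_k})$ where $i_1,\dots,i_k$ are independent uniform elements of $[d]$ (the set $\{i_1,\dots,i_k\}$ is the support of $g$). $\textsc{QueryLSH}(q)$: let $S=\{p\in P:\exists g\in G,\ g(p)=g(q),\ \mathrm{dist}(p,q)\le cr\}$; return any point of $S$, or $\bot$ (''no point'') if $S=\emptyset$. The adversary has only black-box access to $\textsc{QueryLSH}$ (it knows $P,n,d,r,c,\lambda$ but not $G$). Simple adversarial walk (input $z$, $r$, $c$, $\lambda$): set $t=2e^2(\lambda+1)$; sample $q$ uniformly among points at distance $r-t$ from $z$. While $\textsc{QueryLSH}(q)=z$: if $\mathrm{dist}(q,z)\ge r$ return $\bot$; set $q'\leftarrow q$; while $\textsc{QueryLSH}(q')=z$: choose $j$ uniformly from $\{i: q'_i=z_i\}$, flip $q'_j$, and if $\mathrm{dist}(q',z)>cr$ return $\bot$; after this inner loop, flip coordinate $j$ (the last flipped coordinate) in $q$. When the outer loop ends, return $q$. Fast adversarial walk: same, except the inner loop is: set $q^{left},q^{right}\leftarrow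 q$; flip $cr-\mathrm{dist}(q^{right},z)$ uniformly random coordinates of $q^{right}$ among those where $q$ agrees with $z$; if $\textsc{QueryLSH}(q^{right})=z$ return $\bot$; while $\mathrm{dist}(q^{left},q^{right})>1$: let $q^{mid}$ be $q^{left}$ with half of the coordinates where $q^{left}$ and $q^{right}$ differ flipped; if $\textsc{QueryLSH}(q^{mid})=z$ set $q^{left}\leftarrow q^{mid}$, else $q^{right}\leftarrow q^{mid}$; finally let $j$ be the coordinate where $q^{left}$ and $q^{right}$ differ and flip coordinate $j$ in $q$.
   Formalization: The query bounds are proved with max(1,λ) in place of λ, i.e. O(cr·max(1,λ)) and O(log(cr)·max(1,λ)); as stated they fail for λ→0, since each walk always makes at least one query. Distances r−t and cr are rounded down to integers. *)

(* Defs.v *)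
From HB Require Import structures.
From mathcomp Require Import all_boot all_order all_algebra.
From mathcomp Require Import reals sequences exp.

Set Implicit Arguments.
Unset Strict Implicit.
Unset Printing Implicit Defensive.

Import Order.TTheory GRing.Theory Num.Theory.
Local Open Scope ring_scope.

Definition point (d : nat) := {ffun 'I_d -> bool}.

Definition diff_coords (d : nat) (p q : point d) : {set 'I_d} :=
  [set i | p i != q i].

Definition agree_coords (d : nat) (p q : point d) : {set 'I_d} :=
  [set i | p i == q i].

Definition dist (d : nat) (p q : point d) : nat := #|diff_coords p q|.

Definition flip (d : nat) (q : point d) (A : {set 'I_d}) : point d :=
  [ffun i => (i \in A) (+) q i].

Definition mean (R : realType) (T : finType) (S : {set T}) (f : T -> R) : R :=
  (\sum_(x in S) f x) / #|S|%:R.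

(* Here r and c * r are arbitrary reals.  Rounding is only needed
   for sizes: k and L are ceilings as in the construction, and the distances
   r - t and c * r appearing in the walks are rounded down. *)
Definition lsh_p1 (R : realType) (d : nat) (r : R) : R := 1 - r / d%:R.

Definition lsh_p2 (R : realType) (d : nat) (r c : R) : R := 1 - c * r / d%:R.

Definition lsh_rho (R : realType) (d : nat) (r c : R) : R :=
  ln (lsh_p1 d r)^-1 / ln (lsh_p2 d r c)^-1.

Definition lsh_ell (R : realType) (n d : nat) (r c : R) : R :=
  n%:R `^ lsh_rho d r c.

Definition lsh_k (R : realType) (n d : nat) (r c : R) : nat :=
  `|Num.ceil (ln n%:R / ln (lsh_p2 d r c)^-1)|%N.

Definition lsh_L (R : realType) (n d : nat) (r c lam : R) : nat :=
  `|Num.ceil (lam * lsh_ell n d r c)|%N.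

Definition walk_t (R : realType) (lam : R) : R := 2 * expR 2 * (lam + 1).

(* A hash function x |-> (x_{i_1}, ..., x_{i_k}) is given by the tuple of its
   coordinates (i_1, ..., i_k), drawn with replacement. *)
Definition hash_fun (d k : nat) := k.-tuple 'I_d.

Definition hash (d k : nat) (g : hash_fun d k) (x : point d) : k.-tuple bool :=
  map_tuple (fun i => x i) g.

Definition lsh_struct (R : realType) (n d : nat) (r c lam : R) :=
  (lsh_L n d r c lam).-tuple (hash_fun d (lsh_k n d r c)).

Definition candidates (R : realType) (d k L : nat) (P : {set point d})
    (r c : R) (G : L.-tuple (hash_fun d k)) (q : point d) : {set point d} :=
  [set p in P | has (fun g => hash g p == hash g q) G
                & ((dist p q)%:R <= c * r)].

(* "Return any point of S": the query procedure is an arbitrary function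
   subject to this specification. *)
Definition query_lsh_spec (R : realType) (n d : nat) (r c lam : R)
    (P : {set point d})
    (query : lsh_struct n d r c lam -> point d -> option (point d)) : Prop :=
  forall G q,
    match query G q return Prop with
    | Some p => p \in candidates P r c G q
    | None => candidates P r c G q = set0
    end.

(* Randomized algorithms with black-box access to a query procedure:
   [Query] asks one query, [Unif S] draws a uniform element of S. *)
Inductive prog (d : nat) (A : Type) : Type :=
| Ret of A
| Query of point d & (option (point d) -> prog d A)
| Unif (T : finType) of {set T} & (T -> prog d A).

Arguments Ret {d A}.
Arguments Query {d A}.
Arguments Unif {d A T}.

Fixpoint bind (d : nat) (A B : Type) (m : prog d A) (f : A -> prog d B) :
    prog d B :=
  match m with
  | Ret a => f a
  | Query q k => Query q (fun a => bind (k a) f)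
  | Unif _ B k => Unif B (fun x => bind (k x) f)
  end.

(* A draw from the empty set contributes probability 0. *)
Fixpoint prob (R : realType) (d : nat) (A : Type)
    (oracle : point d -> option (point d)) (m : prog d A) (E : pred A) : R :=
  match m with
  | Ret a => (E a)%:R
  | Query q k => prob R oracle (k (oracle q)) E
  | Unif _ B k => mean B (fun x => prob R oracle (k x) E)
  end.

(* Maximum, over all outcomes of the draws, of the number of queries. *)
Fixpoint max_queries (d : nat) (A : Type)
    (oracle : point d -> option (point d)) (m : prog d A) : nat :=
  match m with
  | Ret _ => 0
  | Query q k => (max_queries oracle (k (oracle q))).+1
  | Unif _ B k => \max_(x in B) max_queries oracle (k x)
  end.

(* In the loops below, [fuel] bounds the number of iterations.  Called with
   d.+1 it never runs out: each iteration of [outer_loop] and [simple_inner]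
   flips a coordinate on which the current point still agrees with z, and each
   iteration of [binary_search] decreases dist ql qr.  The outcome "no point"
   of a walk is [None]. *)

(* [find q] is the inner loop: it produces the coordinate to flip in q, or
   [None] when the walk has to stop with no point. *)
Fixpoint outer_loop (R : realType) (d : nat) (z : point d) (r : R)
    (find : point d -> prog d (option 'I_d)) (fuel : nat) (q : point d) :
    prog d (option (point d)) :=
  if fuel is fuel'.+1 then
    Query q (fun a =>
      if a != Some z then Ret (Some q)
      else if r <= (dist q z)%:R then Ret None
      else bind (find q) (fun oj =>
        if oj is Some j then outer_loop z r find fuel' (flip q [set j])
        else Ret None))
  else Ret None.

Definition walk (R : realType) (d : nat) (z : point d) (r lam : R)
    (find : point d -> prog d (option 'I_d)) : prog d (option (point d)) :=
  Unif [set q : point d | dist q z == Num.truncn (r - walk_t lam)]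
    (outer_loop z r find d.+1).

(* [last] is the last flipped coordinate, if any.  The loop is entered with a
   point whose query has just returned z, so it flips at least once. *)
Fixpoint simple_inner (R : realType) (d : nat) (z : point d) (r c : R)
    (fuel : nat) (q' : point d) (last : option 'I_d) :
    prog d (option 'I_d) :=
  if fuel is fuel'.+1 then
    Query q' (fun a =>
      if a != Some z then Ret last
      else Unif (agree_coords q' z) (fun j =>
        let q'' := flip q' [set j] in
        if c * r < (dist q'' z)%:R then Ret None
        else simple_inner z r c fuel' q'' (Some j)))
  else Ret None.

Definition simple_walk (R : realType) (d : nat) (z : point d)
    (r c lam : R) : prog d (option (point d)) :=
  walk z r lam (fun q => simple_inner z r c d.+1 q None).

(* Which half of the differing coordinates is flipped, and how an odd number
   of them is split, is left to an arbitrary rule. *)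
Definition halving_rule (d : nat) (half : point d -> point d -> {set 'I_d}) :
    Prop :=
  forall ql qr, (1 < dist ql qr)%N ->
    half ql qr \subset diff_coords ql qr /\
    ((dist ql qr)./2 <= #|half ql qr| <= uphalf (dist ql qr))%N.

Fixpoint binary_search (d : nat) (z : point d)
    (half : point d -> point d -> {set 'I_d}) (fuel : nat)
    (ql qr : point d) : prog d (option 'I_d) :=
  if fuel is fuel'.+1 then
    if (1 < dist ql qr)%N then
      let qm := flip ql (half ql qr) in
      Query qm (fun a =>
        if a == Some z then binary_search z half fuel' qm qr
        else binary_search z half fuel' ql qm)
    else Ret [pick j in diff_coords ql qr]
  else Ret None.

Definition fast_inner (R : realType) (d : nat) (z : point d) (r c : R)
    (half : point d -> point d -> {set 'I_d}) (q : point d) :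
    prog d (option 'I_d) :=
  Unif [set A : {set 'I_d} | A \subset agree_coords q z
                           & #|A| == (Num.truncn (c * r) - dist q z)%N]
    (fun A =>
      let qr := flip q A in
      Query qr (fun a =>
        if a == Some z then Ret None
        else binary_search z half d.+1 q qr)).

Definition fast_walk (R : realType) (d : nat) (z : point d) (r c lam : R)
    (half : point d -> point d -> {set 'I_d}) : prog d (option (point d)) :=
  walk z r lam (fast_inner z r c half).

Definition finds_false_negative (R : realType) (d : nat)
    (oracle : point d -> option (point d)) (z : point d) (r : R)
    (res : option (point d)) : bool :=
  if res is Some q then ((dist q z)%:R <= r) && (oracle q == None)
  else false.

(* Probability of success over the hash functions, which are L independent
   k-tuples of independent uniform coordinates, and the draws of [alg];
   [alg] has no access to them other than through the oracle. *)
Definition success_prob (R : realType) (n d : nat) (r c lam : R)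
    (query : lsh_struct n d r c lam -> point d -> option (point d))
    (z : point d) (alg : prog d (option (point d))) : R :=
  mean [set: lsh_struct n d r c lam] (fun G =>
    prob R (query G) alg (finds_false_negative (query G) z r)).

(* Main.v *)
Require Import Defs.
From mathcomp Require Import all_boot all_order all_algebra.
From mathcomp Require Import reals sequences exp.
From mathcomp Require Import ring lra zify.
Set Implicit Arguments.
Unset Strict Implicit.
Unset Printing Implicit Defensive.
Import Order.TTheory GRing.Theory Num.Theory.
Local Open Scope ring_scope.

(* Call a hash function g alive at q when g q = g z.  Below distance c r the
   point z is the only possible answer, so a query at q returns z exactly when
   some g is alive, and flipping a coordinate can only kill hash functions.  The
   inner loops look for a coordinate whose flip kills one of them.  At the start
   the expected number of alive functions is at most e (lam + 1), well below
   t = 2 e^2 (lam + 1); if there are at most t, then at most t outer iterations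
   empty the set before the walk leaves the ball of radius r.  An inner loop can
   only fail if a random set of about (c - 1) r coordinates misses the support
   of an alive function.  Supports almost always have at least 3 k / 4 elements,
   so this has probability at most exp (- 3 k (c - 1) r / (4 d)), roughly, for
   every fixed G.  Hence the adaptivity of the walk is harmless: a union bound
   over t functions and t iterations suffices once G is fixed. *)

(** * Randomized programs and coordinates *)

Section Mean.
Context {R : realType} {T : finType}.
Implicit Types (S : {set T}) (f g : T -> R).

Lemma ler_mean S f g :
  {in S, forall x, f x <= g x} -> mean S f <= mean S g.
Proof.
by move=> fg; rewrite ler_wpM2r ?invr_ge0// ler_sum.
Qed.

Lemma mean_ge0 S f : {in S, forall x, 0 <= f x} -> 0 <= mean S f.
Proof. by move=> f0; rewrite mulr_ge0 ?invr_ge0// sumr_ge0. Qed.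

Lemma mean_const S (a : R) : S != set0 -> mean S (fun=> a) = a.
Proof.
move=> S0; rewrite /mean sumr_const -[a *+ _]mulr_natr mulfK//.
by rewrite pnatr_eq0 cards_eq0.
Qed.

Lemma meanB S f g : mean S (fun x => f x - g x) = mean S f - mean S g.
Proof. by rewrite /mean sumrB mulrBl. Qed.

Lemma meanZ S (a : R) f : mean S (fun x => a * f x) = a * mean S f.
Proof. by rewrite /mean -mulr_sumr mulrA. Qed.

End Mean.

Section Prog.
Context {R : realType} {d : nat}.
Variable o : point d -> option (point d).

Lemma prob_ge0 A (m : prog d A) E : 0 <= prob R o m E.
Proof.
elim: m => [a|q k IH|T B k IH] /=; [exact: ler0n|exact: IH|].
by apply: mean_ge0 => x _; exact: IH.
Qed.

Lemma prob_Query A q (k : option (point d) -> prog d A) E :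
  prob R o (Query q k) E = prob R o (k (o q)) E.
Proof. by []. Qed.

Lemma prob_Unif A (T : finType) (U : {set T}) (k : T -> prog d A) E :
  prob R o (Unif U k) E = mean U (fun x => prob R o (k x) E).
Proof. by []. Qed.

Lemma max_queries_Unif A (T : finType) (U : {set T}) (k : T -> prog d A) :
  max_queries o (Unif U k) = \max_(x in U) max_queries o (k x).
Proof. by []. Qed.

(** The oracle keeps no state, so the second stage succeeds with probability at least [v] whatever
    the first has asked. *)
Lemma prob_bind_ge A B (m : prog d A) (f : A -> prog d B) (good : pred A) E v :
  0 <= v -> (forall a, good a -> v <= prob R o (f a) E) ->
  v * prob R o m good <= prob R o (bind m f) E.
Proof.
move=> v0 fv; elim: m => [a|q k IH|T U k IH] /=.
- have [/fv|] := boolP (good a); first by rewrite mulr1.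
  by rewrite mulr0 prob_ge0.
- exact: IH.
- by rewrite -meanZ; apply: ler_mean => x _; exact: IH.
Qed.

(** Covers all draws, but only the answers of the fixed oracle. Query counts rely on it to know that
    the coordinate found lies in the agreement set. *)
Fixpoint always A (m : prog d A) (Q : A -> Prop) : Prop :=
  match m with
  | Ret a => Q a
  | Query q k => always (k (o q)) Q
  | Unif _ U k => forall x, x \in U -> always (k x) Q
  end.

Lemma max_queries_bind A B (m : prog d A) (f : A -> prog d B) Q N :
  always m Q -> (forall a, Q a -> (max_queries o (f a) <= N)%N) ->
  (max_queries o (bind m f) <= max_queries o m + N)%N.
Proof.
move=> + fN; elim: m => [a|q k IH|T U k IH] /=.
- by move=> /fN.
- by move=> /IH; rewrite addSn ltnS.
- move=> H; apply/bigmax_leqP => x xU.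
  apply: leq_trans (IH x (H x xU)) _; rewrite leq_add2r.
  exact: (@leq_bigmax_cond _ (mem U) (fun y => max_queries o (k y))).
Qed.

End Prog.

Section Coords.
Context {d : nat}.
Implicit Types (p q z : point d) (A : {set 'I_d}).

Lemma diff_coordsE p q : diff_coords p q = ~: agree_coords p q.
Proof. by apply/setP => i; rewrite !inE. Qed.

Lemma diff_coordsC p q : diff_coords p q = diff_coords q p.
Proof. by apply/setP => i; rewrite !inE eq_sym. Qed.

Lemma distC p q : dist p q = dist q p.
Proof. by rewrite /dist diff_coordsC. Qed.

Lemma dist_agree p q : (dist p q + #|agree_coords p q|)%N = d.
Proof. by rewrite /dist diff_coordsE addnC cardsC card_ord. Qed.

Lemma dist_triangle p q z : (dist p z <= dist p q + dist q z)%N.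
Proof.
apply: leq_trans (leq_card_setU _ _); apply/subset_leq_card/subsetP => i.
by rewrite !inE; case: (p i) (q i) (z i) => [] [] [].
Qed.

Lemma agree_flip q z A : A \subset agree_coords q z ->
  agree_coords (flip q A) z = agree_coords q z :\: A.
Proof.
move=> /subsetP Az; apply/setP => i; rewrite !inE !ffunE.
have [/Az|] //= := boolP (i \in A).
by rewrite inE => /eqP ->; case: (z i).
Qed.

Lemma dist_flip q z A : A \subset agree_coords q z ->
  dist (flip q A) z = (dist q z + #|A|)%N.
Proof.
move=> Az; have := dist_agree (flip q A) z; have := dist_agree q z.
rewrite agree_flip// cardsD; move/setIidPr: (Az) => ->.
have := subset_leq_card Az; lia.
Qed.

Lemma diff_flip q A : diff_coords q (flip q A) = A.
Proof.
by apply/setP => i; rewrite !inE !ffunE; case: (i \in A); case: (q i).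
Qed.

Lemma diff_flipl p q A : A \subset diff_coords p q ->
  diff_coords (flip p A) q = diff_coords p q :\: A.
Proof.
move=> /subsetP Apq; apply/setP => i; rewrite !inE ffunE.
have [/Apq|] //= := boolP (i \in A).
by rewrite inE; case: (p i) (q i) => [] [].
Qed.

End Coords.

(** * Hash functions that still identify a point with [z] *)

Section Alive.
Context {d L : nat}.
Variables (F : 'I_L -> {set 'I_d}) (z : point d).
Implicit Types (q : point d) (A : {set 'I_d}).

(** A hash function enters the walk only through its support [F i]: it takes the same value at [q]
    and [z] exactly when they agree on that support. *)
Definition alive q : {set 'I_L} := [set i | F i \subset agree_coords q z].

Definition alive_drop q (oj : option 'I_d) : bool :=
  if oj is Some j then
    (j \in agree_coords q z) && (#|alive (flip q [set j])| < #|alive q|)%N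
  else false.

Lemma alive_mono q q' : agree_coords q' z \subset agree_coords q z ->
  alive q' \subset alive q.
Proof.
move=> qq'; apply/subsetP => i; rewrite !inE => /subset_trans; exact.
Qed.

Lemma alive_flip q A i : A \subset agree_coords q z ->
  (i \in alive (flip q A)) = (i \in alive q) && [disjoint F i & A].
Proof. by move=> Aq; rewrite !inE agree_flip// subsetD. Qed.

(* Since agreement only shrinks along a walk, a hash function killed by [j] at a
   later point [q'] was alive at [q] and is killed by [j] there as well. *)
Lemma alive_drop_last q q' j : agree_coords q' z \subset agree_coords q z ->
  j \in agree_coords q' z -> alive q' != set0 ->
  alive (flip q' [set j]) = set0 -> alive_drop q (Some j).
Proof.
move=> qq' jq' /set0Pn[i iq'] e; have jq := subsetP qq' _ jq'.
rewrite /alive_drop jq; apply/proper_card/properP; split.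
  apply: alive_mono; rewrite agree_flip ?sub1set//; exact: subsetDl.
exists i; first exact: (subsetP (alive_mono qq')).
have := in_set0 i; rewrite -e !alive_flip ?sub1set// iq' /= => ->.
by rewrite andbF.
Qed.

End Alive.

(** The quotient of the binomials is the chance that a random m-subset of D elements misses s given
    ones: a product of factors (D - s - i) / (D - i), each at most (D - s) / D. *)
Lemma bin_subr_le (R : realType) (b : R) (D s m : nat) :
  0 <= b -> (s <= D)%N -> (D - s)%:R <= D%:R * b ->
  'C(D - s, m)%:R <= b ^+ m * 'C(D, m)%:R.
Proof.
move=> b0 sD Db; elim: m => [|m IH]; first by rewrite !bin0 expr0 mulr1.
have step : (D - s - m)%:R <= (D - m)%:R * b.
  have [Dm|mD] := leqP D m.
    by rewrite (_ : D - s - m = 0)%N ?mulr_ge0//; lia.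
  have [Dsm|mDs] := leqP (D - s) m.
    by rewrite (_ : D - s - m = 0)%N ?mulr_ge0//; lia.
  have [mD' mDs'] : (m <= D)%N /\ (m <= D - s)%N by lia.
  rewrite !natrB// in Db *.
  have [b1|b1] := leP b 1.
    by have : m%:R * b <= m%:R :> R; [rewrite ler_piMr|lra].
  have : (D%:R - m%:R) <= (D%:R - m%:R) * b.
    by rewrite ler_peMr ?subr_ge0 ?ler_nat// ltW.
  have : (0 : R) <= s%:R by []. lra.
rewrite -(ler_pM2r (ltr0Sn R m)) -natrM -[leRHS]mulrA -natrM.
rewrite ![(_ * m.+1)%N]mulnC !mul_bin_left !natrM exprSr.
have := ler_pM (ler0n _ _) (ler0n _ _) step IH.
by lra.
Qed.

(** * Survival of hash functions along a walk *)

Section Thick.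
Context {R : realType} {d L : nat}.
Variables (F : 'I_L -> {set 'I_d}) (z : point d) (b : R).
Implicit Types (q : point d) (A : {set 'I_d}).

(** [b] bounds the chance that a uniform coordinate misses the support of an alive function. Its
    sign is recorded separately, as the second clause is void when nothing is alive. *)
Definition thick q :=
  0 <= b /\ forall i, i \in alive F z q -> 1 - #|F i|%:R / d%:R <= b.

Lemma thick_mono q q' : agree_coords q' z \subset agree_coords q z ->
  thick q -> thick q'.
Proof.
by move=> qq' [b0 H]; split=> // i /(subsetP (alive_mono F qq')) /H.
Qed.

Lemma thick_card q i : thick q -> i \in alive F z q ->
  (#|agree_coords q z| - #|F i|)%:R <= #|agree_coords q z|%:R * b.
Proof.
move=> [b0 H] iq; have := H i iq; set D := #|agree_coords q z| => Hb.
have FD : (#|F i| <= D)%N by apply: subset_leq_card; move: iq; rewrite inE.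
have Dd : (D <= d)%N by rewrite -[leqRHS](dist_agree q z) leq_addl.
have [d0|d0] := posnP d; first by rewrite (_ : D = 0%N) ?mul0r ?sub0n//; lia.
apply: le_trans (_ : D%:R * (1 - #|F i|%:R / d%:R) <= _); last first.
  by rewrite ler_wpM2l.
rewrite natrB// mulrBr mulr1 lerD2l lerN2 mulrCA ler_piMr//.
by rewrite ler_pdivrMr ?ltr0n// mul1r ler_nat.
Qed.

Lemma sum_alive_flip q (X : {set {set 'I_d}}) :
  {in X, forall A, A \subset agree_coords q z} ->
  (\sum_(A in X) #|alive F z (flip q A)| =
   \sum_(i in alive F z q) #|[set A in X | [disjoint F i & A]]|)%N.
Proof.
move=> Xq; under eq_bigr => A AX.
  rewrite (_ : #|_| = \sum_(i in alive F z q) [disjoint F i & A])%N; last first.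
    rewrite -sum1_card (eq_bigl _ _ (fun i => alive_flip F i (Xq A AX))).
    by rewrite -big_mkcondr.
  over.
rewrite exchange_big /=; apply: eq_bigr => i _.
rewrite -sum1_card (eq_bigl _ _ (fun A => in_set _ A)).
by rewrite [RHS]big_mkcondr.
Qed.

(** Linearity of expectation: the flips sparing function [i] are the [m]-subsets of the agreement
    set minus [F i], and [bin_subr_le] compares the counts. *)
Lemma mean_alive_flip q m : thick q ->
  mean [set A : {set 'I_d} | A \subset agree_coords q z & #|A| == m]
    (fun A => #|alive F z (flip q A)|%:R) <= #|alive F z q|%:R * b ^+ m.
Proof.
move=> tq; have b0 : 0 <= b by case: tq.
rewrite /mean -natr_sum sum_alive_flip; last by move=> A; rewrite inE => /andP[].
rewrite cards_draws; set D := #|agree_coords q z|.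
(* If no set has size [m], division by zero makes the mean 0. *)
have [C0|C0] := posnP 'C(D, m).
  by rewrite C0 invr0 mulr0 mulr_ge0// exprn_ge0.
rewrite ler_pdivrMr ?ltr0n// natr_sum -mulrA mulr_natl.
rewrite -sumr_const; apply: ler_sum => i iq.
rewrite (_ : [set A in _ | _] =
  [set A : {set 'I_d} | A \subset agree_coords q z :\: F i & #|A| == m]); last first.
  by apply/setP => A; rewrite !inE subsetD andbAC [[disjoint A & _]]disjoint_sym.
have FD : F i \subset agree_coords q z by move: iq; rewrite inE.
rewrite cards_draws cardsD (setIidPr FD); apply: bin_subr_le => //.
  exact: subset_leq_card.
exact: thick_card.
Qed.

Lemma mean_alive_flip1 q : thick q ->
  mean (agree_coords q z) (fun j => #|alive F z (flip q [set j])|%:R)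
    <= #|alive F z q|%:R * b.
Proof.
move=> /(mean_alive_flip 1); rewrite expr1; apply: le_trans.
set X := [set A : {set 'I_d} | _ & _].
have XE : X = [set [set j] | j in agree_coords q z].
  apply/setP => A; rewrite !inE; apply/andP/imsetP => [[Aq /cards1P[j Aj]]|].
    by exists j => //; rewrite -sub1set -Aj.
  by move=> [j jq ->]; rewrite sub1set cards1.
rewrite /mean XE big_imset ?card_imset//=; last by move=> ? ? _ _; exact: set1_inj.
exact: set1_inj.
Qed.

End Thick.

Section WalkSuccess.
Context {R : realType} {d L : nat}.
Variables (F : 'I_L -> {set 'I_d}) (z : point d) (b r c : R).
Variable o : point d -> option (point d).
Implicit Types (q : point d) (A : {set 'I_d}).

Let M := Num.truncn (c * r).

Hypothesis cr0 : 0 <= c * r.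
Hypothesis crd : c * r < d%:R.
Hypothesis o_some : forall q, o q = Some z -> alive F z q != set0.
Hypothesis o_none : forall q, (dist q z)%:R < c * r -> o q != Some z ->
  alive F z q = set0 /\ o q = None.

Let Mcr : M%:R <= c * r. Proof. by rewrite truncn_le. Qed.

Let Md : (M < d)%N.
Proof. by rewrite -(ltr_nat R) (le_lt_trans _ crd). Qed.

Let lt_cr q : (dist q z < M)%N -> (dist q z)%:R < c * r.
Proof. by move=> qM; rewrite (lt_le_trans _ Mcr)// ltr_nat. Qed.

(** Markov's inequality in inductive form: each flip multiplies the expected number of alive
    functions by at most [b], and failure requires a survivor after the remaining [M - dist q' z]
    flips. Here [q] is where the loop started and [q'] the current point; the disjunction says that
    something is still alive or that [last] has just killed a function. *)
Lemma simple_inner_good q fuel q' last :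
  agree_coords q' z \subset agree_coords q z -> thick F z b q' ->
  (dist q' z <= M)%N -> (M - dist q' z < fuel)%N ->
  alive F z q' != set0 \/ alive_drop F z q last ->
  1 - #|alive F z q'|%:R * b ^+ (M - dist q' z)
    <= prob R o (simple_inner z r c fuel q' last) (alive_drop F z q).
Proof.
elim: fuel q' last => [//|fuel IH] q' last qq' tq' q'M fuelM inv /=.
have b0 : 0 <= b by case: tq'.
case: ifPn => [oq'|/negPn/eqP oq'] /=.
  have [_|] := boolP (alive_drop F z q last).
    by rewrite lerBlDr lerDl mulr_ge0 ?exprn_ge0.
  case: inv => [aq' _|->//].
  (* An answer other than [z] with functions still alive can occur only at distance [M], where
     [o_none] may not apply; the claimed bound is then at most 0. *)
  have -> : (M - dist q' z = 0)%N.
    apply/eqP; rewrite subn_eq0 leqNgt; apply: contraNN aq' => /lt_cr/o_none.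
    by case=> // ->.
  by rewrite expr0 mulr1 subr_le0 ler1n card_gt0.
have aq' := o_some oq'.
have [q'M'|] := ltnP (dist q' z) M; last first.
  rewrite -subn_eq0 => /eqP ->; rewrite expr0 mulr1.
  apply: (@le_trans _ _ 0); first by rewrite subr_le0 ler1n card_gt0.
  by apply: mean_ge0 => j _; case: ifP => // _; exact: prob_ge0.
have D0 : agree_coords q' z != set0.
  by rewrite -card_gt0; have := dist_agree q' z; lia.
pose m := (M - (dist q' z).+1)%N.
apply: (@le_trans _ _ (mean (agree_coords q' z)
    (fun j => 1 - b ^+ m * #|alive F z (flip q' [set j])|%:R))).
  rewrite meanB mean_const// meanZ lerD2l lerN2.
  rewrite (_ : M - dist q' z = m.+1)%N; last by rewrite /m; lia.
  rewrite exprSr mulrA [_ * b ^+ m]mulrC -mulrA.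
  by rewrite ler_wpM2l ?exprn_ge0// mean_alive_flip1.
apply: ler_mean => j jq'.
have j1 : [set j] \subset agree_coords q' z by rewrite sub1set.
have dj : dist (flip q' [set j]) z = (dist q' z).+1.
  by rewrite dist_flip// cards1 addn1.
have sub : agree_coords (flip q' [set j]) z \subset agree_coords q' z.
  by rewrite agree_flip// subsetDl.
rewrite ltNge ifF; last first.
  by apply/negbF; rewrite dj (le_trans _ Mcr)// ler_nat.
rewrite mulrC /m -dj; apply: IH; rewrite ?dj//.
- exact: subset_trans qq'.
- exact: thick_mono tq'.
- by move: fuelM q'M'; clear; move: M (dist q' z) => x y; lia.
- have [a0|] := eqVneq (alive F z (flip q' [set j])) set0; last by left.
  by right; apply: (alive_drop_last qq').
Qed.

(** Invariant: some function is alive at [ql], none at [qr], and agreement with [z] shrinks from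
    [ql] to [qr]. The last differing coordinate must therefore kill a function. *)
Lemma binary_search_good half q fuel ql qr :
  halving_rule half ->
  agree_coords ql z \subset agree_coords q z ->
  agree_coords qr z \subset agree_coords ql z ->
  alive F z ql != set0 -> alive F z qr = set0 -> (dist qr z <= M)%N ->
  (dist ql qr < fuel)%N ->
  prob R o (binary_search z half fuel ql qr) (alive_drop F z q) = 1.
Proof.
move=> hr; elim: fuel ql qr => [//|fuel IH] ql qr sub_q sub_l al ar qrM lt_fuel.
set D := diff_coords ql qr.
have Dsub : D \subset agree_coords ql z.
  apply/subsetP => i; rewrite inE => ilr; have := subsetP sub_l i; rewrite !inE.
  by move: ilr; case: (ql i) (qr i) (z i) => [] [] [] //= _ /(_ isT).
have qrE : qr = flip ql D.
  by apply/ffunP => i; rewrite !ffunE inE; case: (ql i) (qr i) => [] [].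
rewrite /=; case: ifPn => [/[dup] lr /hr[AD cardA]|] /=; last first.
  rewrite -leqNgt => D1.
  have D0 : D != set0.
    apply: contraNneq al => D0; rewrite -ar qrE D0.
    by apply/eqP; congr alive; apply/ffunP => i; rewrite !ffunE inE.
  have {D1}/cards1P[j DE] : #|D| == 1%N by rewrite eqn_leq D1 card_gt0.
  case: pickP => [j'|/(_ j)]; rewrite -/D DE inE ?eqxx// => /eqP ->.
  rewrite (alive_drop_last sub_q)//; last by rewrite -ar qrE DE.
  by rewrite -sub1set -DE.
set A := half ql qr in AD cardA *; set qm := flip ql A.
have DE : #|D| = dist ql qr by [].
have Asub : A \subset agree_coords ql z := subset_trans AD Dsub.
have sub_m : agree_coords qm z \subset agree_coords ql z.
  by rewrite agree_flip// subsetDl.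
have sub_r : agree_coords qr z \subset agree_coords qm z.
  by rewrite [in X in X \subset _]qrE !agree_flip// setDS.
have dm : dist ql qm = #|A| by rewrite /dist diff_flip.
have dmr : dist qm qr = (#|D| - #|A|)%N.
  by rewrite /dist diff_flipl// cardsD (setIidPr AD).
have cA : (0 < #|A| < #|D|)%N.
  rewrite DE; move: cardA lr; clear; move: (dist ql qr) #|A| => m n; lia.
have dqr : dist qr z = (dist ql z + #|D|)%N by rewrite qrE dist_flip.
have dqm : dist qm z = (dist ql z + #|A|)%N by rewrite dist_flip.
(* The midpoint is strictly closer to [z] than [qr], hence below distance [M], where the answer
   decides whether a function is alive. *)
have [mr [rm qmM]] : (dist ql qm < fuel)%N /\
    ((dist qm qr < fuel)%N /\ (dist qm z < M)%N).
  rewrite dm dmr dqm; move: cA lt_fuel qrM; rewrite dqr -DE; clear.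
  by move: #|A| #|D| (dist ql z) M => a e l m; lia.
case: ifPn => [/eqP/o_some am|/o_none om].
  by apply: IH => //; exact: subset_trans sub_q.
by case: om => [|am _]; [exact: lt_cr|apply: IH => //; exact: ltnW].
Qed.

Lemma fast_inner_good half q : halving_rule half -> thick F z b q ->
  alive F z q != set0 -> (dist q z <= M)%N ->
  1 - #|alive F z q|%:R * b ^+ (M - dist q z)
    <= prob R o (fast_inner z r c half q) (alive_drop F z q).
Proof.
move=> hr tq aq qM; rewrite /fast_inner -/M prob_Unif.
set X := [set A : {set 'I_d} | _ & _].
have X0 : X != set0.
  by rewrite -card_gt0 cards_draws bin_gt0; have := dist_agree q z; lia.
apply: (@le_trans _ _ (mean X (fun A => 1 - #|alive F z (flip q A)|%:R))).
  by rewrite meanB mean_const// lerD2l lerN2; exact: mean_alive_flip.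
apply: ler_mean => A; rewrite inE => /andP[Aq /eqP cA].
have [a0|a0] := eqVneq (alive F z (flip q A)) set0; last first.
  apply: (@le_trans _ _ 0); first by rewrite subr_le0 ler1n card_gt0.
  exact: prob_ge0.
(* The right end may lie at distance exactly [c * r], out of reach of [o_none]; the contrapositive
   of [o_some] serves instead. *)
rewrite a0 cards0 subr0 prob_Query ifN; last first.
  by apply/eqP => /o_some; rewrite a0 eqxx.
have dA : dist (flip q A) z = (dist q z + #|A|)%N by rewrite dist_flip.
rewrite binary_search_good//.
- by rewrite agree_flip// subsetDl.
- by lia.
- by rewrite /dist diff_flip; lia.
Qed.

(** An iteration adds 1 to the distance and removes at least one alive function, so their sum stays
    at most [r] and the functions run out inside the ball. A union bound charges [eta] per
    iteration. *)
Lemma outer_loop_success (find : point d -> prog d (option 'I_d)) (eta : R)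
    fuel q :
  r < c * r -> 0 <= eta ->
  (forall q', agree_coords q' z \subset agree_coords q z ->
     (dist q' z)%:R < r -> o q' = Some z ->
     1 - eta <= prob R o (find q') (alive_drop F z q')) ->
  (dist q z)%:R + #|alive F z q|%:R <= r -> (#|alive F z q| < fuel)%N ->
  1 - #|alive F z q|%:R * eta
    <= prob R o (outer_loop z r find fuel q) (finds_false_negative o z r).
Proof.
move=> rcr eta0; elim: fuel q => [//|fuel IH] q findP dr lt_fuel /=.
have dqr : (dist q z)%:R <= r.
  by apply: le_trans dr; rewrite lerDl.
case: ifPn => [oq|/negPn/eqP oq] /=.
  have [_ ->] := o_none (le_lt_trans dqr rcr) oq.
  by rewrite dqr eqxx lerBlDr lerDl mulr_ge0.
have aq : (0 < #|alive F z q|)%N by rewrite card_gt0 o_some.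
have dqr' : (dist q z)%:R < r.
  by apply: lt_le_trans dr; rewrite ltrDl ltr0n.
rewrite [r <= _]leNgt dqr' /=.
set n := #|alive F z q| in aq lt_fuel dr *.
(* [prob_bind_ge] needs a nonnegative factor; a negative one makes the claim trivial. *)
have [v0|v0] := leP 0 (1 - n.-1%:R * eta); last first.
  apply: le_trans (prob_ge0 _ _ _); apply: ltW; apply: le_lt_trans v0.
  by rewrite lerD2l lerN2 ler_wpM2r// ler_nat leq_pred.
apply: (@le_trans _ _ ((1 - n.-1%:R * eta) * (1 - eta))).
  have -> : n%:R = n.-1%:R + 1 :> R by rewrite natr1 prednK.
  have ? : 0 <= n.-1%:R * eta * eta by rewrite !mulr_ge0.
  lra.
apply: (@le_trans _ _ ((1 - n.-1%:R * eta) * prob R o (find q) (alive_drop F z q))).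
  by rewrite ler_wpM2l//; exact: findP.
apply: prob_bind_ge => // -[j|//] /= /andP[jq aj].
have j1 : [set j] \subset agree_coords q z by rewrite sub1set.
have an : (#|alive F z (flip q [set j])| <= n.-1)%N.
  by rewrite -ltnS prednK.
apply: le_trans (IH _ _ _ _).
- by rewrite lerD2l lerN2 ler_wpM2r// ler_nat.
- move=> q' qq'; apply: findP; apply: subset_trans qq' _.
  by rewrite agree_flip// subsetDl.
- apply: le_trans dr; rewrite dist_flip// cards1 -!natrD ler_nat.
  by rewrite -addnA leq_add2l add1n -(prednK aq) ltnS.
- by rewrite (leq_ltn_trans an)// -ltnS prednK.
Qed.

End WalkSuccess.

(** * Counting queries along a walk *)

Section WalkQueries.
Context {R : realType} {d : nat}.
Variables (z : point d) (r c : R).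
Variable o : point d -> option (point d).
Implicit Types (q : point d) (A : {set 'I_d}).

Definition in_agree q (oj : option 'I_d) : Prop :=
  if oj is Some j then j \in agree_coords q z else True.

(** Each iteration moves [q] one step away from [z], so at most [X] occur before radius [r]. Each
    costs one query plus the inner loop, and one last query ends the walk. *)
Lemma outer_loop_queries (find : point d -> prog d (option 'I_d)) N X fuel q :
  (forall q', always o (find q') (in_agree q')) ->
  (forall q', (dist q' z)%:R < r -> (max_queries o (find q') <= N)%N) ->
  r <= (dist q z + X)%:R ->
  (max_queries o (outer_loop z r find fuel q) <= X * N.+1 + 1)%N.
Proof.
move=> findA findN; elim: fuel X q => [//|fuel IH] X q rX /=.
case: ifP => //= _; first by rewrite addn1.
case: leP => //= qr; first by rewrite addn1.
case: X rX => [|X] rX; first by rewrite addn0 leNgt qr in rX.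
rewrite addn1 ltnS.
apply: leq_trans (max_queries_bind (N := (X * N.+1 + 1)%N) (findA q) _) _.
  case=> //= j jq.
  apply: IH; apply: le_trans rX _.
  by rewrite dist_flip ?sub1set// cards1 ler_nat; lia.
by have := findN q qr; lia.
Qed.

Let M := Num.truncn (c * r).

Lemma simple_inner_agree q fuel q' last :
  agree_coords q' z \subset agree_coords q z -> in_agree q last ->
  always o (simple_inner z r c fuel q' last) (in_agree q).
Proof.
elim: fuel q' last => [//|fuel IH] q' last qq' lastP /=.
case: ifP => //= _ j jq'; case: ifP => //= _.
apply: IH; last exact: (subsetP qq').
by rewrite agree_flip ?sub1set//; apply: subset_trans qq'; exact: subsetDl.
Qed.

Lemma simple_inner_queries fuel q last : (dist q z <= M)%N ->
  (max_queries o (simple_inner z r c fuel q last) <= (M - dist q z).+1)%N.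
Proof.
elim: fuel q last => [//|fuel IH] q last qM /=.
case: ifP => //= _; rewrite ltnS; apply/bigmax_leqP => j jq.
case: ltP => //= djr.
have dj : dist (flip q [set j]) z = (dist q z).+1.
  by rewrite dist_flip ?sub1set// cards1 addn1.
have djM : (dist (flip q [set j]) z <= M)%N.
  by rewrite truncn_ge_nat// (le_trans _ djr).
by apply: leq_trans (IH _ _ djM) _; lia.
Qed.

Lemma binary_search_agree half q fuel ql qr :
  halving_rule half ->
  agree_coords ql z \subset agree_coords q z ->
  diff_coords ql qr \subset agree_coords ql z ->
  always o (binary_search z half fuel ql qr) (in_agree q).
Proof.
move=> hr; elim: fuel ql qr => [//|fuel IH] ql qr sub_q sub_l /=.
case: ifP => [/hr[AD _]|_] /=; last first.
  case: pickP => //= j /(subsetP sub_l); exact: (subsetP sub_q).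
have Asub := subset_trans AD sub_l.
case: ifP => _; apply: IH => //; last by rewrite diff_flip.
  by rewrite agree_flip//; apply: subset_trans sub_q; exact: subsetDl.
by rewrite agree_flip// diff_flipl// setSD.
Qed.

(** The halving rule bounds the flipped half on both sides, so either remaining interval has length
    at most [uphalf (dist ql qr)]. *)
Lemma binary_search_queries half fuel ql qr e : halving_rule half ->
  (dist ql qr <= 2 ^ e)%N ->
  (max_queries o (binary_search z half fuel ql qr) <= e)%N.
Proof.
move=> hr; elim: fuel e ql qr => [//|fuel IH] e ql qr de /=.
case: ifP => [/[dup] d1 /hr[AD cA]|//] /=.
case: e de => [|e] de; first by rewrite expn0 leqNgt d1 in de.
have de2 : (uphalf (dist ql qr) <= 2 ^ e)%N by rewrite expnS in de; lia.
rewrite ltnS; set A := half ql qr in AD cA *.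
case: ifP => _; apply: IH; last by rewrite /dist diff_flip; lia.
by rewrite /dist diff_flipl// cardsD (setIidPr AD) -/(dist ql qr); lia.
Qed.

Lemma fast_inner_agree half q : halving_rule half ->
  always o (fast_inner z r c half q) (in_agree q).
Proof.
move=> hr A; rewrite inE => /andP[Aq _].
change (always o (if o (flip q A) == Some z then Ret None
  else binary_search z half d.+1 q (flip q A)) (in_agree q)).
case: ifP => // _.
by apply: binary_search_agree => //; rewrite diff_flip.
Qed.

Lemma fast_inner_queries half q e : halving_rule half -> (M <= 2 ^ e)%N ->
  (max_queries o (fast_inner z r c half q) <= e.+1)%N.
Proof.
move=> hr Me; apply/bigmax_leqP => A; rewrite inE => /andP[_ /eqP cA].
change ((max_queries o (if o (flip q A) == Some z
  then Ret None else binary_search z half d.+1 q (flip q A))).+1 <= e.+1)%N.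
rewrite ltnS.
case: ifP => // _; apply: binary_search_queries => //.
by rewrite /dist diff_flip cA; apply: leq_trans Me; exact: leq_subr.
Qed.

End WalkQueries.

(** * Random hash functions *)

Section TupleSums.
Context {R : realType} {T : finType}.

Lemma sum_tuple_prod n (F : 'I_n -> T -> R) :
  \sum_(g : n.-tuple T) \prod_i F i (tnth g i) = \prod_i \sum_x F i x.
Proof.
rewrite bigA_distr_bigA (reindex (@finfun_of_tuple T n)) /=; last first.
  exists (@tuple_of_finfun T n) => g _.
    exact: finfun_of_tupleK.
  exact: tuple_of_finfunK.
by apply: eq_bigr => g _; apply: eq_bigr => i _; rewrite ffunE.
Qed.

Lemma mean_setT (f : T -> R) : mean [set: T] f = (\sum_x f x) / #|T|%:R.
Proof. by rewrite /mean cardsT; under eq_bigl do rewrite inE. Qed.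

End TupleSums.

Lemma mean_tuple_sum (R : realType) (T : finType) n (w : T -> R) :
  (0 < #|T|)%N ->
  mean [set: n.-tuple T] (fun g => \sum_(i < n) w (tnth g i))
    = n%:R * mean [set: T] w.
Proof.
move=> T0; rewrite !mean_setT exchange_big /= card_tuple.
have T0' : #|T|%:R != 0 :> R by rewrite pnatr_eq0 -lt0n.
rewrite (eq_bigr (fun=> (\sum_x w x) * #|T|%:R ^+ n.-1)); last first.
  move=> i _; rewrite (eq_bigr (fun g : n.-tuple T =>
      \prod_j (if j == i then w (tnth g j) else 1))); last first.
    by move=> g _; rewrite -big_mkcond big_pred1_eq.
  rewrite (sum_tuple_prod (fun j x => if j == i then w x else 1)) (bigD1 i)//= eqxx; congr (_ * _).
  rewrite (eq_bigr (fun=> #|T|%:R)); last first.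
    by move=> j /negbTE ->; rewrite sumr_const.
  by rewrite prodr_const cardC1 card_ord.
rewrite sumr_const card_ord.
case: n => [|n]; first by rewrite mulr0n !mul0r.
rewrite -[_ *+ _]mulr_natl /= natrX exprS -!mulrA; congr (_ * (_ * _)).
by rewrite invfM mulrCA mulfV ?expf_neq0// mulr1.
Qed.

Section Support.
Context {R : realType} {d k : nat}.
Implicit Types (g : hash_fun d k) (B : {set 'I_d}).

Definition supp g : {set 'I_d} := [set j in g].

(** Ordered pairs are counted, so each coincidence appears twice; an overestimate of the repetitions
    suffices. *)
Definition collisions g : nat :=
  (\sum_(a < k) \sum_(b < k | b != a) (tnth g a == tnth g b))%N.

Lemma supp_sub g B : (supp g \subset B) = [forall i, tnth g i \in B].
Proof.
apply/subsetP/forallP => [gB i|gB j]; first by apply: gB; rewrite inE mem_tnth.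
by rewrite inE => /tnthP[i ->].
Qed.

(** Positions whose coordinate occurs once inject into the support; every other position takes part
    in a collision. *)
Lemma leq_supp_collisions g : (k <= #|supp g| + collisions g)%N.
Proof.
pose U := [set a | [forall b, (b != a) ==> (tnth g a != tnth g b)]].
have Us : (#|U| <= #|supp g|)%N.
  rewrite -(card_in_imset (f := tnth g) (D := mem U)).
    apply/subset_leq_card/subsetP => _ /imsetP[a _ ->].
    by rewrite inE mem_tnth.
  move=> a b /=; rewrite inE => /forallP/(_ b) + _ ab.
  by rewrite ab eqxx implybF negbK => /eqP.
have Uc : (#|~: U| <= collisions g)%N.
  rewrite -sum1_card big_mkcond /=; apply: leq_sum => a _.
  rewrite !inE; case: ifPn => // /forallPn[b]; rewrite negb_imply negbK.
  by case/andP=> ba ab; rewrite (bigD1 b)//= ab.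
by rewrite -{1}(card_ord k) -(cardsC U) leq_add.
Qed.

Lemma sum_supp_sub B :
  \sum_(g : hash_fun d k) (supp g \subset B)%:R = #|B|%:R ^+ k :> R.
Proof.
rewrite (eq_bigr (fun g : hash_fun d k => \prod_i (tnth g i \in B)%:R)).
  rewrite (sum_tuple_prod (fun _ x => (x \in B)%:R)).
  rewrite (eq_bigr (fun=> #|B|%:R)) ?prodr_const ?card_ord// => i _.
  by rewrite -sum1_card natr_sum [RHS]big_mkcond; apply: eq_bigr => x _; case: ifP.
move=> g _; rewrite supp_sub; case: forallP => [gB|/forallP/forallPn[i gi]].
  by rewrite big1// => i _; rewrite gB.
by rewrite (bigD1 i)//= (negbTE gi) mul0r.
Qed.

(** Fixing the common value [v] at [a] and [b] leaves [k - 2] free positions in [B]. The leading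
    factor [#|B|] avoids a division. *)
Lemma sum_supp_sub_collide B (a b : 'I_k) : b != a ->
  #|B|%:R * \sum_(g : hash_fun d k)
    (supp g \subset B)%:R * (tnth g a == tnth g b)%:R = #|B|%:R ^+ k :> R.
Proof.
move=> ba; pose F v (i : 'I_k) (x : 'I_d) : R :=
  ((x \in B) && ((i \in [set a; b]) ==> (x == v)))%:R.
rewrite (eq_bigr (fun g : hash_fun d k =>
    \sum_(v in B) \prod_i F v i (tnth g i))); last first.
  move=> g _; rewrite supp_sub; case: (boolP [forall i, _]) => [/forallP gB|].
    rewrite mul1r (bigD1 (tnth g a))//= [X in _ = _ + X]big1 ?addr0; last first.
      move=> v /andP[_ va]; rewrite (bigD1 a)//= /F !inE eqxx/= eq_sym.
      by rewrite (negbTE va) andbF mul0r.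
    have [ab|ab] := eqVneq (tnth g a) (tnth g b).
      rewrite big1// => i _; rewrite /F gB !inE.
      by case: eqP => [->|_]; [rewrite eqxx|case: eqP => [->|//]; rewrite ab eqxx].
    rewrite (bigD1 b)//= /F !inE eqxx orbT /= eq_sym (negbTE ab) andbF.
    by rewrite mul0r.
  move=> /forallPn[i gi]; rewrite mul0r big1// => v _.
  by rewrite (bigD1 i)//= /F (negbTE gi) mul0r.
rewrite exchange_big /=.
have k2 : (1 < k)%N.
  by have := ltn_ord a; have := ltn_ord b; move: ba; rewrite -val_eqE /=; lia.
rewrite (eq_bigr (fun=> #|B|%:R ^+ k.-2)); last first.
  move=> v vB; rewrite (sum_tuple_prod (F v)).
  rewrite (bigID (fun i => i \in [set a; b])) /= big1 ?mul1r; last first.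
    move=> i iab; rewrite (bigD1 v)//= /F iab vB eqxx big1 ?addr0//.
    by move=> x /negbTE ->; rewrite andbF.
  rewrite (eq_bigr (fun=> #|B|%:R)); last first.
    move=> i /negbTE iab; rewrite -sum1_card natr_sum [RHS]big_mkcond.
    by apply: eq_bigr => x _; rewrite /F iab andbT; case: ifP.
  rewrite prodr_const; congr (_ ^+ _).
  have := cardsC [set a; b]; rewrite cards2 eq_sym ba card_ord => kE.
  rewrite -[k in RHS]kE /= -cardsE.
  by apply: eq_card => i; rewrite !inE.
rewrite sumr_const -[_ ^+ _ *+ _]mulr_natl -exprS -exprS.
by case: (k) k2 => [|[|]].
Qed.

(** Given that the support lies in [B], the entries are uniform on [B], and each of the at most k^2
    ordered pairs collides with probability 1 / |B|. *)
Lemma mean_weight_le B (x y : R) : (0 < d)%N -> (0 < #|B|)%N -> 0 <= y ->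
  mean [set: hash_fun d k]
    (fun g => (supp g \subset B)%:R * (x + y * (collisions g)%:R))
  <= (#|B|%:R / d%:R) ^+ k * (x + y * (k%:R ^+ 2 / #|B|%:R)).
Proof.
move=> d0 B0 y0; rewrite mean_setT card_tuple card_ord natrX exprMn exprVn.
rewrite mulrAC; apply: ler_wpM2r; first by rewrite invr_ge0 exprn_ge0.
under eq_bigr do rewrite mulrDr mulrC mulrCA.
rewrite big_split /= -!mulr_sumr sum_supp_sub mulrDr [x * _]mulrC lerD2l.
rewrite [leRHS]mulrCA ler_wpM2l// mulrA ler_pdivlMr ?ltr0n// mulrC.
under eq_bigr do rewrite natr_sum mulr_sumr.
rewrite exchange_big mulr_sumr /= expr2 mulrA.
rewrite (_ : _ * k%:R = \sum_(a < k) (#|B|%:R ^+ k * k%:R)); last first.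
  by rewrite sumr_const card_ord mulr_natr.
apply: ler_sum => a _.
under eq_bigr do rewrite natr_sum mulr_sumr.
rewrite exchange_big mulr_sumr /=.
rewrite (eq_bigr (fun=> #|B|%:R ^+ k)); last first.
  by move=> b ba; exact: sum_supp_sub_collide.
rewrite sumr_const -[leLHS]mulr_natr ler_wpM2l ?exprn_ge0// ler_nat.
by rewrite -[leqRHS]card_ord max_card.
Qed.

End Support.

Lemma mean_exchange (R : realType) (S T : finType) (A : {set S}) (B : {set T})
    (f : S -> T -> R) :
  mean A (fun x => mean B (f x)) = mean B (fun y => mean A (f^~ y)).
Proof.
rewrite /mean -!mulr_suml exchange_big /= -!mulrA.
by rewrite [X in _ * X]mulrC.
Qed.

Lemma sphere_neq0 (d m : nat) (z : point d) : (m <= d)%N ->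
  [set q : point d | dist q z == m] != set0.
Proof.
move=> md; have : (0 < #|[set A : {set 'I_d} | #|A| == m]|)%N.
  by rewrite card_draws card_ord bin_gt0.
rewrite card_gt0 => /set0Pn[A]; rewrite inE => /eqP cA.
by apply/set0Pn; exists (flip z A); rewrite inE distC /dist diff_flip cA.
Qed.

(** * Averaging over the data structure *)

Section Lsh.
Context {R : realType} {n d : nat} {r c lam : R}.
Variables (P : {set point d}) (z : point d).
Variable query : lsh_struct n d r c lam -> point d -> option (point d).

Local Notation k := (lsh_k n d r c).
Local Notation L := (lsh_L n d r c lam).
Local Notation t := (walk_t lam).
Implicit Types (G : lsh_struct n d r c lam) (q : point d).

Definition supports G (i : 'I_L) : {set 'I_d} := supp (tnth G i).

Lemma alive_supports G q i :
  (i \in alive (supports G) z q) = (hash (tnth G i) z == hash (tnth G i) q).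
Proof.
rewrite inE supp_sub; apply/forallP/eqP => [H|H j].
  apply: eq_from_tnth => j; rewrite !tnth_map.
  by have := H j; rewrite inE => /eqP.
by rewrite inE; have := congr1 (fun s => tnth s j) H; rewrite !tnth_map => ->.
Qed.

Lemma has_hash_alive G q :
  has (fun g => hash g z == hash g q) G = (alive (supports G) z q != set0).
Proof.
apply/hasP/set0Pn => [[g /tnthP[i ->] gz]|[i]].
  by exists i; rewrite alive_supports.
by rewrite alive_supports; exists (tnth G i) => //; exact: mem_tnth.
Qed.

Hypothesis spec : query_lsh_spec P query.
Hypothesis zP : z \in P.
Hypothesis far : forall p, p \in P -> p != z -> 2 * c * r <= (dist p z)%:R.

Lemma query_some G q : query G q = Some z -> alive (supports G) z q != set0.
Proof.
move=> Gq; have := spec G q; rewrite Gq inE => /and3P[_ + _].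
by rewrite has_hash_alive.
Qed.

(** By the triangle inequality another answer would lie at distance less than 2 c r from [z],
    against [far]; the strict bound on [dist q z] is what makes this contradictory. *)
Lemma query_none G q : (dist q z)%:R < c * r -> query G q != Some z ->
  alive (supports G) z q = set0 /\ query G q = None.
Proof.
move=> qz; have := spec G q; case: (query G q) => [p|] /=.
  rewrite inE => /and3P[pP _ pq] pz; have {}pz : p != z.
    by apply: contraNneq pz => ->.
  have := far pP pz; have : (dist p z)%:R <= (dist p q)%:R + (dist q z)%:R :> R.
    by rewrite -natrD ler_nat dist_triangle.
  by move=> ? ?; exfalso; lra.
move=> C0 _; split=> //; apply/eqP; apply: contraT => aq.
have : z \in candidates P r c G q by rewrite inE zP has_hash_alive aq distC ltW.
by rewrite C0 inE.
Qed.

(* If the weights of the hash functions of [G] at [q] sum to less than 1, then at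
   most [t] of them are alive at [q] and each of those has fewer than [k / 4]
   collisions among its coordinates, hence a support of at least [3 k / 4]. *)
Definition weight q (g : hash_fun d k) : R :=
  (supp g \subset agree_coords q z)%:R * (t^-1 + 4 / k%:R * (collisions g)%:R).

Hypothesis t0 : 0 < t.
Hypothesis k0 : (0 < k)%N.

Let b : R := expR (- (3 / 4 * k%:R / d%:R)).

Lemma weight_alive G q :
  \sum_i weight q (tnth G i) =
  \sum_(i in alive (supports G) z q)
     (t^-1 + 4 / k%:R * (collisions (tnth G i))%:R).
Proof.
rewrite [RHS]big_mkcond; apply: eq_bigr => i _; rewrite /weight inE.
by case: (_ \subset _); rewrite (mul1r, mul0r).
Qed.

Let k0R : 0 < k%:R :> R. Proof. by rewrite ltr0n. Qed.

Lemma weight_lt1_alive G q : \sum_i weight q (tnth G i) < 1 ->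
  #|alive (supports G) z q|%:R <= t.
Proof.
rewrite weight_alive big_split /= sumr_const => lt1.
have : 0 <= \sum_(i in alive (supports G) z q)
    4 / k%:R * (collisions (tnth G i))%:R :> R.
  by apply: sumr_ge0 => i _; rewrite !mulr_ge0// invr_ge0.
move: lt1; rewrite -[t^-1 *+ _]mulr_natl => lt1 s0.
by rewrite -[leRHS]mul1r -ler_pdivrMr//; lra.
Qed.

Lemma weight_lt1_thick G q : \sum_i weight q (tnth G i) < 1 ->
  thick (supports G) z b q.
Proof.
rewrite weight_alive => lt1; split; first exact: expR_ge0.
(* [b] dominates 1 - 3k / (4d), so it remains to find 3k / 4 elements in the support. *)
move=> i iq; apply: le_trans (expR_ge1Dx _); rewrite lerD2l lerN2.
rewrite ler_wpM2r ?invr_ge0//.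
have : t^-1 + 4 / k%:R * (collisions (tnth G i))%:R < 1.
  apply: le_lt_trans lt1; rewrite (bigD1 i)//= lerDl.
  by apply: sumr_ge0 => j _; rewrite addr_ge0 ?mulr_ge0 ?invr_ge0 ?(ltW t0).
have := leq_supp_collisions (tnth G i); rewrite -(ler_nat R) natrD.
have : 0 < t^-1 by rewrite invr_gt0.
move: (collisions _)%:R => x ti ks /(lt_trans (_ : 4 / k%:R * x < _)) H.
have : 4 / k%:R * x < 1 by apply: H; rewrite ltrDr.
rewrite mulrAC ltr_pdivrMr// mul1r => ?.
rewrite /supports; lra.
Qed.

Let M := Num.truncn (c * r).
Let x0 := Num.truncn (r - t).

Hypothesis tr : t <= r.
Hypothesis rcr : r < c * r.
Hypothesis crd : c * r < d%:R.
Hypothesis miss_le : forall x : nat, x%:R < r -> t * (t * b ^+ (M - x)) <= 1 / 4.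
Hypothesis weight_le :
  L%:R * (((d - x0)%:R / d%:R) ^+ k *
    (t^-1 + 4 / k%:R * (k%:R ^+ 2 / (d - x0)%:R))) <= 2 / 3.

(** For fixed [G] and start [q] of total weight W, success has probability at least 3/4 (1 - W): if
    W < 1, at most t iterations fail with chance at most 1 / (4t) each. The mean of W is at most
    2/3, which leaves 1/4. *)
Lemma walk_success (find : point d -> prog d (option 'I_d)) :
  (forall G q, thick (supports G) z b q -> alive (supports G) z q != set0 ->
     (dist q z <= M)%N ->
     1 - #|alive (supports G) z q|%:R * b ^+ (M - dist q z)
       <= prob R (query G) (find q) (alive_drop (supports G) z q)) ->
  1 / 4 <= success_prob query z (walk z r lam find).
Proof.
move=> findP; move: (t0) (tr) (rcr) (crd) => t0' tr' rcr' crd'.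
have r0 : 0 < r := lt_le_trans t0 tr.
have cr0 : 0 <= c * r by rewrite ltW// (lt_trans r0).
have x0r : x0%:R <= r - t by rewrite truncn_le subr_ge0.
have x0d : (x0 < d)%N by rewrite -(ltr_nat R) (le_lt_trans x0r)//; lra.
pose X := [set q : point d | dist q z == x0].
pose W G q := \sum_i weight q (tnth G i).
have W0 G q : 0 <= W G q.
  apply: sumr_ge0 => i _.
  by rewrite mulr_ge0// addr_ge0 ?mulr_ge0 ?invr_ge0 ?(ltW t0).
have step G q : q \in X -> 3 / 4 * (1 - W G q) <=
    prob R (query G) (outer_loop z r find d.+1 q)
      (finds_false_negative (query G) z r).
  rewrite inE => /eqP qx0.
  have [W1|W1] := ltP (W G q) 1; last by apply: le_trans (prob_ge0 _ _ _); lra.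
  have at_t := weight_lt1_alive W1; have tq := weight_lt1_thick W1.
  have eta0 : 0 <= 1 / 4 / t by rewrite !divr_ge0 ?(ltW t0).
  apply: le_trans (outer_loop_success (@query_some G)
    (@query_none G) rcr eta0 _ _ _).
  - have : #|alive (supports G) z q|%:R * (1 / 4 / t) <= 1 / 4.
      by rewrite mulrCA -[leRHS]mulr1 ler_wpM2l ?divr_ge0 ?ler_pdivrMr ?mul1r.
    by have := W0 G q; lra.
  - move=> q' qq' q'r oq'.
    apply: le_trans (findP G q' _ _ _).
    + rewrite lerD2l lerN2 ler_pdivlMr// [_ * t]mulrC.
      apply: le_trans (miss_le q'r); rewrite ler_wpM2l ?(ltW t0)//.
      rewrite ler_wpM2r ?exprn_ge0 ?expR_ge0//.
      apply: le_trans at_t; rewrite ler_nat; apply/subset_leq_card.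
      exact: alive_mono.
    + exact: thick_mono tq.
    + exact: query_some.
    + by rewrite truncn_ge_nat//; lra.
  - by rewrite qx0; lra.
  (* The fuel suffices: at most t <= r < d functions are alive. *)
  - by rewrite -(ltr_nat R) -natr1; lra.
rewrite /success_prob /walk.
apply: (@le_trans _ _ (mean [set: lsh_struct n d r c lam]
    (fun G => mean X (fun q => 3 / 4 * (1 - W G q))))); last first.
  by apply: ler_mean => G _; apply: ler_mean => q; exact: step.
(* The start is independent of the hash functions, so these are averaged first, with [q] fixed. *)
rewrite mean_exchange; have X0 : X != set0 by apply: sphere_neq0; exact: ltnW.
rewrite -[leLHS](mean_const _ X0); apply: ler_mean => q; rewrite inE => /eqP qx0.
have d0 : (0 < d)%N by exact: leq_ltn_trans x0d.
have h0 : (0 < #|{: hash_fun d k}|)%N by rewrite card_tuple card_ord expn_gt0 d0.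
have s0 : [set: lsh_struct n d r c lam] != set0.
  by rewrite -card_gt0 cardsT card_tuple expn_gt0 h0.
rewrite meanZ meanB mean_const// mean_tuple_sum//.
have Dq : #|agree_coords q z| = (d - x0)%N.
  by apply: (@addnI x0); rewrite subnKC ?(ltnW x0d)// -[in LHS]qx0 dist_agree.
have : L%:R * mean [set: hash_fun d k] (weight q) <= 2 / 3.
  apply: le_trans weight_le; rewrite ler_wpM2l//.
  apply: le_trans (mean_weight_le _ _ _ _) _ => //.
  - by rewrite Dq subn_gt0.
  - by rewrite divr_ge0.
  - by rewrite Dq.
lra.
Qed.

Lemma simple_walk_success :
  1 / 4 <= success_prob query z (simple_walk z r c lam).
Proof.
move: (t0) (tr) (rcr) (crd) => t0' tr' rcr' crd'.
apply: walk_success => G q tq aq qM.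
have cr0 : 0 <= c * r by lra.
apply: (simple_inner_good cr0 crd (@query_some G) (@query_none G)) => //.
  rewrite ltnS; apply: leq_trans (leq_subr _ _) _.
  by rewrite ltnW// -(ltr_nat R) (le_lt_trans _ crd)// truncn_le.
by left.
Qed.

Lemma fast_walk_success half : halving_rule half ->
  1 / 4 <= success_prob query z (fast_walk z r c lam half).
Proof.
move: (t0) (tr) (rcr) (crd) => t0' tr' rcr' crd' hr.
apply: walk_success => G q tq aq qM.
have cr0 : 0 <= c * r by lra.
exact: (fast_inner_good cr0 crd (@query_some G) (@query_none G)).
Qed.

End Lsh.

(** * Numerical estimates *)

Section Estimates.
Context {R : realType}.

Lemma natr_ceil_bounds (x : R) : 0 <= x ->
  x <= (`|Num.ceil x|%N)%:R /\ (`|Num.ceil x|%N)%:R <= x + 1.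
Proof.
move=> x0; have c0 : 0 <= Num.ceil x by rewrite ceil_ge0 (lt_le_trans _ x0)// ltrN10.
have /andP[lt le] := ceil_itv x.
have -> : (`|Num.ceil x|%N)%:R = (Num.ceil x)%:~R :> R.
  by rewrite natr_absz ger0_norm.
split=> //; move: lt; rewrite intrB; lra.
Qed.

Lemma ln_inv1B_bounds (y : R) : 0 < y -> y < 1 ->
  y <= ln (1 - y)^-1 /\ ln (1 - y)^-1 <= y / (1 - y).
Proof.
move=> y0 y1; have y1' : 0 < 1 - y by lra.
split.
  by rewrite lnV ?posrE//; have := @le_ln1Dx R (- y); lra.
have -> : ln (1 - y)^-1 = ln (1 + y / (1 - y)) by congr ln; field; lra.
by apply: le_ln1Dx; apply: lt_trans (ltrN10 _) _; rewrite divr_gt0.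
Qed.

(* In terms of the statement, [N] is [ln n] and [u] is [lam + 1]. *)
Record regime (N d r c u : R) : Prop := Regime {
  regime_N : 9 <= N;
  regime_r : 28 * N ^+ 3 <= r;
  regime_d : 28 * N * r <= d;
  regime_c1 : 1 < c;
  regime_cN : c <= N;
  regime_u : 1 < u;
  regime_uN : 8 * expR 2 * u <= expR (N / 8);
  regime_ur : 8 * expR 2 * u * N <= r;
  regime_cu : 80 + 16 * ln u <= (c - 1) * N
}.

(** The constants are 2268 = 28 * 81 and 252 = 28 * 9, from N >= 9, and 2240 = 28 * 80, from (c - 1)
    N >= 80 and r >= 28 N. *)
Lemma regime_bounds (N d r c u : R) : regime N d r c u ->
  [/\ 2268 * N <= r, 252 * r <= d, 28 * (c * r) <= d & 2240 <= (c - 1) * r].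
Proof.
case=> N9 rN dr c1 cN u1 uN ur cu.
have N2 : 81 <= N ^+ 2 by rewrite expr2; nra.
have r0 : 2268 * N <= r by apply: le_trans rN; rewrite exprS; nra.
have a0 : 0 < ln u by rewrite ln_gt0.
split=> //; [nra|nra|].
have : N <= r / 28 by lra.
nra.
Qed.

Lemma expR1_ge2 : 2 <= expR 1 :> R.
Proof. by have := @expR_ge1Dx R 1; lra. Qed.

Lemma expR2 : expR 2 = expR 1 ^+ 2 :> R.
Proof. by rewrite -expRM_natl mulr1. Qed.

(** With y = c r / d <= 1/28, ln (1 / p_2) lies between y and y / (1 - y). The ceiling adds at most
    y to k y, and y <= N / 252 because N >= 9. *)
Lemma hash_length_bounds (n d : nat) (r c u : R) :
  regime (ln n%:R) d%:R r c u ->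
  27 / 28 * (ln n%:R * d%:R) <= (lsh_k n d r c)%:R * (c * r) /\
  (lsh_k n d r c)%:R * (c * r) <= 253 / 252 * (ln n%:R * d%:R).
Proof.
move=> H; have [r0 dr dcr _] := regime_bounds H.
case: H => N9 _ _ c1 _ _ _ _ _.
set N := ln n%:R in N9 r0 *; set D : R := d%:R in dr dcr *.
have cr0 : 0 < c * r by nra.
have D0 : 0 < D by lra.
pose y := c * r / D.
have y0 : 0 < y by rewrite divr_gt0.
have y28 : y <= 1 / 28 by rewrite /y ler_pdivrMr//; lra.
have [yL Ly] : y <= ln (lsh_p2 d r c)^-1 /\
    ln (lsh_p2 d r c)^-1 <= y / (1 - y).
  by apply: ln_inv1B_bounds => //; lra.
rewrite /lsh_k; set La := ln (lsh_p2 d r c)^-1 in yL Ly *.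
have La0 : 0 < La by lra.
have [|kl ku] := @natr_ceil_bounds (N / La); first by rewrite divr_ge0//; lra.
set k : R := (`|Num.ceil _|%N)%:R in kl ku *.
have yE : c * r = y * D by rewrite /y; field; lra.
clearbody y; rewrite yE !mulrA.
have Lay : La * (1 - y) <= y by rewrite -ler_pdivlMr//; lra.
have kl' : N <= k * La by rewrite -ler_pdivrMr.
have ku' : (k - 1) * La <= N by rewrite -ler_pdivlMr//; lra.
have k1 : 1 <= k by nra.
split; apply: ler_wpM2r; rewrite ?(ltW D0)//.
  have : k * (La * (1 - y)) <= k * y by rewrite ler_wpM2l//; lra.
  have : N * (1 - y) <= k * La * (1 - y) by rewrite ler_wpM2r//; lra.
  have : N * (27 / 28) <= N * (1 - y) by rewrite ler_wpM2l//; lra.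
  lra.
have : (k - 1) * y <= (k - 1) * La by rewrite ler_wpM2l//; lra.
lra.
Qed.

End Estimates.

Section RealEstimates.
Context {R : realFieldType}.

(** Supplies the hypothesis of [survival_ratio_le]. Since t <= r / (4N) and 4N <= r / 567, K (t + 1)
    is at most slightly above D / 4. *)
Lemma collision_exponent_le (N D r t K : R) : 9 <= N -> 2268 * N <= r ->
  252 * r <= D -> 0 < K -> t * (4 * N) <= r ->
  K * r <= 253 / 252 * (N * D) -> K * (t + 1) <= D - r.
Proof.
move=> N9 Nr rD K0 tr Kr.
have h1 : (t + 1) * (4 * N) <= r * (569 / 567) by lra.
have h2 : K * ((t + 1) * (4 * N)) <= K * (r * (569 / 567)).
  by rewrite ler_wpM2l// ltW.
have h3 : N * (K * (t + 1)) <= N * (253 / 252 * D * (569 / 567) / 4) by lra.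
have h4 : K * (t + 1) <= 253 / 252 * D * (569 / 567) / 4.
  by move: h3; rewrite ler_pM2l//; lra.
lra.
Qed.

(** [u * e] bounds the expected number of functions alive at the start, and [2 * e ^+ 2 * u] is t.
    The first term is 1 / (2e) <= 1/4; the second is at most about 1/4, by 8 e^2 u N <= r and e >=
    2. *)
Lemma weight_terms_le (N D X r u e K : R) : 9 <= N -> 0 < K -> 0 < u -> 2 <= e ->
  0 < D -> 251 / 252 * D <= D - X -> 8 * e ^+ 2 * u * N <= r ->
  K * r <= 253 / 252 * (N * D) ->
  u * e * ((2 * e ^+ 2 * u)^-1 + 4 * K / (D - X)) <= 2 / 3.
Proof.
move=> N9 K0 u0 e2 D0 DX ur Kr.
have e0 : 0 < e by lra.
have p1 : u * e * (2 * e ^+ 2 * u)^-1 <= 1 / 4.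
  have -> : u * e * (2 * e ^+ 2 * u)^-1 = e^-1 / 2.
    by field; rewrite !gt_eqF.
  have : e^-1 <= 2^-1 by rewrite lef_pV2 ?posrE//; lra.
  lra.
have p2 : u * e * (4 * K / (D - X)) <= 253 / 251 / 4.
  rewrite mulrA ler_pdivrMr; last by lra.
  have h1 : K * (8 * e ^+ 2 * u * N) <= 253 / 252 * (N * D).
    by apply: le_trans Kr; rewrite ler_wpM2l ?(ltW K0).
  have h2 : N * (8 * e ^+ 2 * u * K) <= N * (253 / 252 * D) by lra.
  have h3 : 8 * e ^+ 2 * u * K <= 253 / 252 * D.
    by move: h2; rewrite ler_pM2l//; lra.
  have h4 : 0 <= e * u * K * (e - 2).
    by rewrite mulr_ge0 ?subr_ge0// !mulr_ge0 ?(ltW e0) ?(ltW u0) ?(ltW K0).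
  lra.
lra.
Qed.

(** One factor 27/28 comes from the estimate of [k], another from the -1 in the number of flips, and
    3/4 (27/28)^2 >= 2/3. *)
Lemma miss_exponent_ge (N D r c k m : R) : 0 <= N -> 0 < D -> 1 < c -> 0 < r ->
  28 <= (c - 1) * r -> 27 / 28 * (N * D) <= k * (c * r) ->
  (c - 1) * r - 1 <= m ->
  2 / 3 * (N * (c - 1) / c) <= 3 / 4 * k / D * m.
Proof.
move=> N0 D0 c1 r0 cr28 kl ml.
have c0 : 0 < c by lra.
have cr0 : 0 < c * r by rewrite mulr_gt0.
have m0 : 27 / 28 * ((c - 1) * r) <= m by lra.
have kd : 27 / 28 * (N / (c * r)) <= k / D.
  have -> : 27 / 28 * (N / (c * r)) = 27 / 28 * (N * D) / (c * r) / D.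
    by field; rewrite !gt_eqF.
  by rewrite ler_wpM2r ?invr_ge0 ?(ltW D0)// ler_pdivrMr.
have f0 : 0 <= N * (c - 1) / c.
  by rewrite divr_ge0 ?(ltW c0)// mulr_ge0// subr_ge0 ltW.
have q0 : 0 <= 27 / 28 * (N / (c * r)) by rewrite mulr_ge0 ?divr_ge0 ?(ltW cr0).
have s0 : 0 <= 27 / 28 * ((c - 1) * r) by lra.
have := ler_pM q0 s0 kd m0.
have -> : 27 / 28 * (N / (c * r)) * (27 / 28 * ((c - 1) * r)) =
    (27 / 28) ^+ 2 * (N * (c - 1) / c) by field; rewrite !gt_eqF.
have -> : 3 / 4 * k / D * m = 3 / 4 * (k / D * m) by field; rewrite gt_eqF.
move: (N * (c - 1) / c) (k / D * m) f0 => f g f0; lra.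
Qed.

End RealEstimates.

Section LshEstimates.
Context {R : realType} (n d : nat) (r c lam : R).
Hypothesis H : regime (ln n%:R) d%:R r c (lam + 1).

Local Notation N := (ln n%:R).
Local Notation k := (lsh_k n d r c).
Local Notation t := (walk_t lam).

(** As k >= log n / log (1 / p_2), p_1^k <= n^(-rho) = 1 / ell; the ceiling in L adds at most p_1^k
    <= 1. *)
Lemma lsh_size_p1 : (lsh_L n d r c lam)%:R * lsh_p1 d r ^+ k <= lam + 1.
Proof.
have [r0 dr dcr _] := regime_bounds H.
case: H => N9 _ _ c1 _ u1 _ _ _.
have lam0 : 0 <= lam by rewrite -(lerD2r 1) add0r ltW.
have D0 : 0 < d%:R :> R by lra.
have n0 : n%:R != 0 :> R by apply: contraTneq N9 => ->; rewrite ln0// -ltNge.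
set p1 := lsh_p1 d r; set a := ln p1^-1; set La := ln (lsh_p2 d r c)^-1.
have rd : r / d%:R <= 1 / 252 by rewrite ler_pdivrMr//; lra.
have rd0 : 0 < r / d%:R by rewrite divr_gt0//; lra.
have p10 : 0 < p1 by rewrite /p1 /lsh_p1; lra.
have p11 : p1 <= 1 by rewrite /p1 /lsh_p1; lra.
have a0 : 0 <= a.
  have rd1 : r / d%:R < 1 by lra.
  have [+ _] := ln_inv1B_bounds rd0 rd1.
  by rewrite -/(lsh_p1 d r) -/p1 -/a; lra.
have La0 : 0 < La.
  have crd : c * r / d%:R <= 1 / 28 by rewrite ler_pdivrMr//; lra.
  have crd0 : 0 < c * r / d%:R by rewrite divr_gt0// mulr_gt0//; lra.
  have crd1 : c * r / d%:R < 1 by lra.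
  have [+ _] := ln_inv1B_bounds crd0 crd1.
  by rewrite -/(lsh_p2 d r c) -/La; lra.
have p1E m : p1 ^+ m = expR (- (a * m%:R)).
  rewrite -[p1 in LHS]lnK ?posrE// -expRM_natr; congr expR.
  by rewrite /a lnV ?posrE//; ring.
have kl : N / La <= k%:R.
  by case: (@natr_ceil_bounds R (N / La)) => //; rewrite divr_ge0//; lra.
have ellE : lsh_ell n d r c = expR (a / La * N).
  by rewrite /lsh_ell /powR (negbTE n0).
have ell0 : 0 <= lsh_ell n d r c by rewrite ellE expR_ge0.
have ellp : lsh_ell n d r c * p1 ^+ k <= 1.
  rewrite ellE p1E -expRD -[leRHS]expR0 ler_expR subr_le0 -mulrA ler_wpM2l//.
  by rewrite [La^-1 * _]mulrC.
have [_ Lu] := natr_ceil_bounds (mulr_ge0 lam0 ell0).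
apply: (@le_trans _ _ ((lam * lsh_ell n d r c + 1) * p1 ^+ k)).
  by rewrite ler_wpM2r// exprn_ge0// ltW.
rewrite mulrDl mul1r -mulrA lerD//.
  by rewrite -[leRHS]mulr1 ler_wpM2l.
exact: exprn_ile1 (ltW p10) p11.
Qed.

Lemma walk_t_bounds : [/\ 0 < t, t * (4 * N) <= r & 4 * t <= expR (N / 8)].
Proof.
case: H => N9 _ _ _ _ u1 uN ur _; rewrite /walk_t.
have e2 := @expR_gt0 R 2; split; [|lra|lra].
by rewrite !mulr_gt0//; lra.
Qed.

(** 1 - x/d = (1 - r/d) (1 + (r - x) / (d - r)), so starting inside the ball costs at most a factor
    exp (m (r - x) / (d - r)) <= e. *)
Lemma survival_ratio_le (x m : nat) : r < d%:R -> (x <= d)%N -> x%:R <= r ->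
  m%:R * (r - x%:R) <= d%:R - r ->
  ((d - x)%:R / d%:R) ^+ m <= lsh_p1 d r ^+ m * expR 1.
Proof.
move=> rd xd xr; rewrite natrB// /lsh_p1.
move: (d%:R) (x%:R : R) rd xr (ler0n R x) => D X rD xr X0 mle.
have Dr0 : 0 < D - r by rewrite subr_gt0.
have D0 : 0 < D := le_lt_trans (le_trans X0 xr) rD.
have p10 : 0 <= 1 - r / D by rewrite subr_ge0 ler_pdivrMr// mul1r ltW.
have step : (D - X) / D <= (1 - r / D) * expR ((r - X) / (D - r)).
  have -> : (D - X) / D = (1 - r / D) * (1 + (r - X) / (D - r)).
    by field; rewrite !gt_eqF.
  by rewrite ler_wpM2l// expR_ge1Dx.
apply: (@le_trans _ _ (((1 - r / D) * expR ((r - X) / (D - r))) ^+ m)).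
  apply: lerXn2r => //; rewrite nnegrE.
    by rewrite divr_ge0 ?(ltW D0)// subr_ge0 (le_trans xr)// ltW.
  by rewrite mulr_ge0 ?expR_ge0.
rewrite exprMn ler_wpM2l ?exprn_ge0//.
by rewrite -expRM_natl ler_expR mulrA ler_pdivrMr// mul1r.
Qed.

Lemma weight_mass_le (x : nat) : x%:R <= r - t -> r - t < x%:R + 1 ->
  (lsh_L n d r c lam)%:R * (((d - x)%:R / d%:R) ^+ k *
    (t^-1 + 4 / k%:R * (k%:R ^+ 2 / (d - x)%:R))) <= 2 / 3.
Proof.
move=> xr rx; have [r0 dr dcr _] := regime_bounds H.
have [kl ku] := hash_length_bounds H.
have [t0 tr _] := walk_t_bounds.
have tE : t = 2 * expR 1 ^+ 2 * (lam + 1) by rewrite /walk_t expR2.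
move: (survival_ratio_le (x := x) (m := k)).
move: k (lsh_L _ _ _ _ _) t tE xr rx t0 tr kl ku lsh_size_p1.
move=> k L t tE xr rx t0 tr kl ku Lp.
have [N9 _ _ c1 _ u1 _ ur _] := H.
rewrite expR2 in ur.
move: (lam + 1) (lsh_p1 d r ^+ k) tE Lp u1 ur => u pk tE Lp u1 ur.
move: N N9 r0 tr kl ku ur => N N9 r0 tr kl ku ur.
have rp : 0 < r by lra.
have D0 : 0 < d%:R :> R by lra.
have cr0 : 0 < c * r by rewrite mulr_gt0//; lra.
have k0 : 0 < k%:R :> R.
  rewrite -(pmulr_lgt0 _ cr0); apply: lt_le_trans kl.
  by rewrite !mulr_gt0//; lra.
have xd : (x <= d)%N by rewrite -(ler_nat R); lra.
have kr : k%:R * r <= 253 / 252 * (N * d%:R).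
  apply: le_trans ku; rewrite ler_wpM2l ?(ltW k0)// ler_peMl ?(ltW rp)//.
  exact: ltW.
have ce := collision_exponent_le N9 r0 dr k0 tr kr.
move=> /(_ _ xd _ _) ratio.
have {ratio} : ((d - x)%:R / d%:R) ^+ k <= pk * expR 1.
  apply: ratio; [lra|lra|].
  (* Rounding [r - t] down to [x] loses less than one, so r - x < t + 1. *)
  apply: le_trans ce; rewrite ler_wpM2l ?(ltW k0)//; lra.
rewrite natrB//; move: ((_ / _) ^+ k) => rho rho_le.
have DX : 251 / 252 * d%:R <= d%:R - x%:R :> R by lra.
have e2 := @expR1_ge2 R.
move: (expR 1) tE rho_le e2 ur => e tE rho_le e2 ur.
have u0 : 0 < u := lt_trans ltr01 u1.
have -> : 4 / k%:R * (k%:R ^+ 2 / (d%:R - x%:R)) = 4 * k%:R / (d%:R - x%:R) :> R.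
  by rewrite expr2 !mulrA mulfVK ?gt_eqF.
apply: le_trans (weight_terms_le N9 k0 u0 e2 D0 DX ur kr).
rewrite -tE mulrA ler_wpM2r//.
  rewrite addr_ge0 ?invr_ge0 ?(ltW t0)// divr_ge0 ?mulr_ge0 ?(ltW k0)//.
  by apply: le_trans DX; rewrite mulr_ge0 ?divr_ge0 ?(ltW D0).
apply: (@le_trans _ _ (L%:R * (pk * e))); first by rewrite ler_wpM2l.
by rewrite mulrA ler_wpM2r// (le_trans _ e2).
Qed.

Lemma miss_mass_le (x : nat) : x%:R < r ->
  t * (t * expR (- (3 / 4 * k%:R / d%:R)) ^+ (Num.truncn (c * r) - x)) <= 1 / 4.
Proof.
move=> xr; have [r0 dr dcr cr2] := regime_bounds H.
have [kl _] := hash_length_bounds H.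
have [t0 _ tN] := walk_t_bounds.
have tE : t = 2 * expR (2 + ln (lam + 1)).
  by rewrite expRD lnK ?posrE ?mulrA//; have := regime_u H; lra.
move: k t kl t0 tN tE => k t kl t0 tN tE.
have [N9 _ _ c1 _ u1 _ _ cu] := H.
have a0 : 0 < ln (lam + 1) by rewrite ln_gt0.
move: (ln (lam + 1)) N a0 tE N9 r0 kl tN cu => a N a0 tE N9 r0 kl tN cu.
have rp : 0 < r by lra.
have D0 : 0 < d%:R :> R by lra.
have cr0 : 0 < c * r by rewrite mulr_gt0//; lra.
have rcr : r <= c * r by rewrite ler_peMl ?(ltW rp)// ltW.
have /andP[_ Mu] := truncn_itv (ltW cr0).
have xM : (x <= Num.truncn (c * r))%N.
  by rewrite truncn_ge_nat ?(ltW cr0)// (le_trans (ltW xr)).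
rewrite -expRM_natr mulNr natrB//.
rewrite -natr1 in Mu; move: (Num.truncn (c * r))%:R Mu => M Mu.
pose f := N * (c - 1) / c.
have Ef : 2 / 3 * f <= 3 / 4 * k%:R / d%:R * (M - x%:R).
  by apply: (miss_exponent_ge (r := r)) => //; lra.
rewrite mulrA; apply: (@le_trans _ _ (t * t * expR (- (2 / 3 * f)))).
  by rewrite ler_wpM2l ?mulr_ge0 ?(ltW t0)// ler_expR lerN2.
move: Ef => _.
(* For c <= 2, (c - 1) N >= 80 + 16 a gives an exponent of at least 26 + 5 a, against t^2 = 4 exp (4
   + 2 a). For c > 2, (c - 1) / c >= 1/2 gives at least N / 3, against t^2 <= exp (N / 4) / 16. *)
have [c2|c2] := leP c 2.
  have f3 : 26 + 5 * a <= 2 / 3 * f.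
    rewrite /f mulrA ler_pdivlMr; last by lra.
    have : (26 + 5 * a) * c <= (26 + 5 * a) * 2 by rewrite ler_wpM2l//; lra.
    lra.
  have -> : t * t * expR (- (2 / 3 * f)) =
      4 * expR (2 + a + (2 + a) - 2 / 3 * f).
    by rewrite tE; move: (2 + a) => s; rewrite (expRD (s + s)) (expRD s); ring.
  have : expR (2 + a + (2 + a) - 2 / 3 * f) <= expR (- 22).
    by rewrite ler_expR; lra.
  have : expR (- 22) <= 1 / 16 :> R.
    rewrite expRN div1r lef_pV2 ?posrE ?expR_gt0//.
    by have := @expR_ge1Dx R 22; lra.
  lra.
have f2 : N / 2 <= f.
  rewrite /f ler_pdivlMr; last by lra.
  have : N * 2 <= N * c by rewrite ler_wpM2l//; lra.
  lra.
have tt : t * t <= expR (N / 4) / 16.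
  have : 4 * t * (4 * t) <= expR (N / 8) * expR (N / 8).
    by rewrite ler_pM// mulr_ge0// ltW.
  rewrite -expRD (_ : N / 8 + N / 8 = N / 4); last by field.
  by move: (expR _) => p; lra.
apply: (@le_trans _ _ (expR (N / 4) / 16 * expR (- (2 / 3 * f)))).
  by rewrite ler_wpM2r ?expR_ge0.
rewrite mulrAC -expRD.
have : expR (N / 4 - 2 / 3 * f) <= 1 by rewrite -[leRHS]expR0 ler_expR; lra.
by move: (expR _) => p; lra.
Qed.

End LshEstimates.

(** * Explicit constants for the query bounds *)

Section QueryBounds.
Context {R : realType} {d : nat}.
Variables (z : point d) (r c lam : R).
Variable o : point d -> option (point d).

Local Notation t := (walk_t lam).

Hypothesis lam0 : 0 < lam.
Hypothesis tr : t <= r.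
Hypothesis r4 : 4 <= r.
Hypothesis c1 : 1 < c.

Let t0 : 0 <= t.
Proof. by rewrite /walk_t !mulr_ge0 ?expR_ge0 ?addr_ge0 ?(ltW lam0). Qed.

Let cr4 : 4 <= c * r.
Proof. by apply: le_trans r4 _; rewrite ler_peMl ?(ltW c1)// (le_trans _ r4). Qed.

Let cr0 : 0 <= c * r. Proof. exact: le_trans cr4. Qed.

Let m := Num.max 1 lam.

Let m1 : 1 <= m. Proof. by rewrite le_max lexx. Qed.

Lemma walk_queries (find : point d -> prog d (option 'I_d)) (b : nat) (B : R) :
  (forall q, always o (find q) (in_agree z q)) ->
  (forall q, (dist q z)%:R < r -> (max_queries o (find q) <= b)%N) ->
  b.+1%:R <= 5 * B -> 1 <= B ->
  (max_queries o (walk z r lam find))%:R <= 5 * (4 * expR 2 + 3) * (B * m).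
Proof.
move=> findA findN bB B1.
(* One extra unit makes up for rounding [t], the other for rounding [r - t]. *)
pose X := (Num.truncn t).+2.
have Xt : X%:R <= t + 2.
  by rewrite /X -addn2 natrD lerD2r truncn_le.
have tX : t + 1 <= X%:R.
  by have /andP[_ /ltW] := truncn_itv t0; rewrite /X -[_.+2%:R]natr1 lerD2r.
have tm : t + 2 <= (4 * expR 2 + 2) * m.
  have lm : lam <= m by rewrite le_max lexx orbT.
  have : 2 * expR 2 * (lam + 1) <= 2 * expR 2 * (2 * m).
    by rewrite ler_wpM2l ?mulr_ge0 ?expR_ge0//; have := m1; lra.
  by rewrite -/t; have := m1; lra.
apply: (@le_trans _ _ (X * b.+1 + 1)%:R).
  rewrite ler_nat /walk max_queries_Unif; apply/bigmax_leqP => q; rewrite inE => /eqP qx.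
  apply: (outer_loop_queries d.+1 findA findN).
  rewrite natrD qx; have rt0 : 0 <= r - t by rewrite subr_ge0.
  have /andP[_] := truncn_itv rt0; rewrite -natr1.
  move: (Num.truncn (r - t))%:R (X%:R : R) tX => x y; lra.
rewrite natrD natrM.
have XB : X%:R * b.+1%:R <= (4 * expR 2 + 2) * m * (5 * B).
  by apply: ler_pM => //; apply: le_trans tm.
have mB : 1 <= m * B by rewrite -[leLHS]mulr1 ler_pM.
by apply: le_trans (lerD XB mB) _; lra.
Qed.

Lemma simple_walk_queries :
  (max_queries o (simple_walk z r c lam))%:R
    <= 5 * (4 * expR 2 + 3) * (c * r * m).
Proof.
have Mcr : (Num.truncn (c * r))%:R <= c * r by rewrite truncn_le.
apply: (walk_queries (b := (Num.truncn (c * r)).+1)).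
- by move=> q; apply: simple_inner_agree.
- move=> q qr; have qM : (dist q z <= Num.truncn (c * r))%N.
    rewrite truncn_ge_nat//; apply: le_trans (ltW qr) _.
    by rewrite ler_peMl ?(ltW c1)// (le_trans _ r4).
  apply: leq_trans (simple_inner_queries o d.+1 None qM) _.
  by rewrite ltnS leq_subr.
- rewrite -addn2 natrD; move: Mcr cr4.
  by move: (c * r) (Num.truncn _)%:R => y x; lra.
- by move: cr4; move: (c * r) => y; lra.
Qed.

Lemma fast_walk_queries half : halving_rule half ->
  (max_queries o (fast_walk z r c lam half))%:R
    <= 5 * (4 * expR 2 + 3) * (ln (c * r) * m).
Proof.
move=> hr; set M := Num.truncn (c * r).
have Mcr : M%:R <= c * r by rewrite truncn_le.
have M0 : (0 < M)%N by rewrite truncn_gt0 (le_trans _ cr4)// ler1n.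
pose e := trunc_log 2 M.
have ln2 : 2^-1 <= ln 2 :> R.
  have := @le_ln1Dx R (- 2^-1); rewrite (_ : 1 - 2^-1 = 2^-1); last by field.
  by rewrite lnV ?posrE// lerN2; apply; lra.
have eln : e%:R * 2^-1 <= ln (c * r).
  apply: (@le_trans _ _ (ln (2 ^ e)%:R)).
    by rewrite natrX lnXn// -[leRHS]mulr_natl ler_wpM2l.
  rewrite ler_ln ?posrE ?ltr0n ?expn_gt0//; last exact: lt_le_trans cr4.
  by apply: le_trans Mcr; rewrite ler_nat trunc_logP.
have ln1 : 1 <= ln (c * r).
  apply: (@le_trans _ _ (ln (2 ^ 2)%:R)).
    by rewrite natrX lnXn// -[leRHS]mulr_natl; lra.
  by rewrite ler_ln ?posrE ?ltr0n// (lt_le_trans _ cr4).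
(* As M < 2^(e + 1), the search takes at most e + 1 queries after the one at its right end. Then e +
   3 <= 5 ln (c r), by e <= 2 ln (c r) and ln (c r) >= 1. *)
apply: (walk_queries (b := e.+2)).
- by move=> q; apply: fast_inner_agree.
- move=> q _; apply: fast_inner_queries => //.
  exact/ltnW/trunc_log_ltn.
- rewrite -addn3 natrD; move: eln ln1.
  by move: (ln _) => y; lra.
- by move: ln1; move: (ln _) => y; lra.
Qed.

End QueryBounds.

(* Num.max 1 lam: lam may be arbitrarily small, while every run makes at least
   one query. For 1 <= lam these are the bounds O(c r lam) and
   O(log(c r) lam). *)
Theorem mainTheorem1 (R : realType) :
  exists2 K : R, 0 < K &
  forall (n d : nat) (r c lam : R) (P : {set point d}) (z : point d)
    (query : lsh_struct n d r c lam -> point d -> option (point d))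
    (half : point d -> point d -> {set 'I_d}),
  expR 1 < n%:R :> R ->
  28 * ln n%:R ^+ 3 <= r ->
  r <= d%:R / (28 * ln n%:R) ->
  0 < lam ->
  lam <= 1 / (8 * expR 2) * Num.min (r / ln n%:R) (n%:R `^ (1 / 8)) - 1 ->
  1 < c ->
  1 + (80 + 16 * ln (lam + 1)) / ln n%:R <= c ->
  c <= ln n%:R ->
  #|P| = n ->
  query_lsh_spec P query ->
  halving_rule half ->
  z \in P ->
  (forall p, p \in P -> p != z -> 2 * c * r <= (dist p z)%:R) ->
  [/\ 1 / 4 - 1 / n%:R <= success_prob query z (simple_walk z r c lam),
      (forall G, (max_queries (query G) (simple_walk z r c lam))%:R
                 <= K * (c * r * Num.max 1 lam)),
      1 / 4 - 1 / n%:R <= success_prob query z (fast_walk z r c lam half)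
    & (forall G, (max_queries (query G) (fast_walk z r c lam half))%:R
                 <= K * (ln (c * r) * Num.max 1 lam))].
Proof.
exists (5 * (4 * expR 2 + 3)).
  by have := @expR_gt0 R 2; lra.
move=> n d r c lam P z query half n_gt rN rd lam0 lamle c1 c_ge c_le _
  spec hr zP far.
have n0 : 0 < n%:R :> R by apply: lt_trans n_gt; exact: expR_gt0.
have N0 : 0 < ln n%:R :> R.
  by rewrite ln_gt0// (lt_trans _ n_gt)// -[ltLHS]expR0 ltr_expR.
have e2 := @expR_gt0 R 2.
have u1 : 1 < lam + 1 by lra.
have a0 : 0 < ln (lam + 1) by rewrite ln_gt0.
have cu : 80 + 16 * ln (lam + 1) <= (c - 1) * ln n%:R.
  by rewrite -ler_pdivrMr//; lra.
have reg : regime (ln n%:R) d%:R r c (lam + 1).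
  have lam' : 8 * expR 2 * (lam + 1) <=
      Num.min (r / ln n%:R) (n%:R `^ (1 / 8)).
    rewrite mulrC -ler_pdivlMr; last by rewrite mulr_gt0.
    by move: lamle; rewrite [_ * Num.min _ _]mulrC div1r; lra.
  move: lam'; rewrite le_min => /andP[ur un]; split=> //.
  (* With c <= N, the bound on (c - 1) N forces (N - 1) N > 80, whereas N < 9 would give at most
     72. *)
  - rewrite leNgt; apply/negP => N9.
    have : (c - 1) * ln n%:R <= (ln n%:R - 1) * ln n%:R.
      by rewrite ler_wpM2r ?(ltW N0)// lerD2r.
    have : (ln n%:R - 1) * ln n%:R <= 8 * 9 :> R.
      have [N1|N1] := leP 1 (ln n%:R : R); first by apply: ler_pM; lra.
      by apply: (@le_trans _ _ 0); [rewrite mulr_le0_ge0//; lra|lra].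
    lra.
  - by rewrite mulrC -ler_pdivlMr// mulr_gt0.
  - by move: un; rewrite /powR gt_eqF// div1r [8^-1 * _]mulrC.
  - by rewrite -ler_pdivlMr.
have [r0 dr dcr _] := regime_bounds reg.
have [t0 tr _] := walk_t_bounds reg.
have [kl _] := hash_length_bounds reg.
have N9 := regime_N reg.
have rp : 0 < r by lra.
have r4 : 4 <= r by lra.
have d0 : 0 < d%:R :> R by lra.
have cr0 : 0 < c * r by rewrite mulr_gt0//; lra.
have k0 : (0 < lsh_k n d r c)%N.
  rewrite -(ltr0n R) -(pmulr_lgt0 _ cr0); apply: lt_le_trans kl.
  by rewrite mulr_gt0 ?divr_gt0 ?mulr_gt0.
have tr' : walk_t lam <= r.
  apply: le_trans tr; rewrite ler_peMr ?(ltW t0)//; lra.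
have rcr : r < c * r by rewrite ltr_pMl.
have crd : c * r < d%:R by lra.
have rt0 : 0 <= r - walk_t lam by rewrite subr_ge0.
have /andP[x0l x0u] := truncn_itv rt0; rewrite -natr1 in x0u.
have weight_le := weight_mass_le reg x0l x0u.
have quarter : 1 / 4 - 1 / n%:R <= 1 / 4 :> R.
  by rewrite lerBlDr lerDl divr_ge0// ltW.
split.
- apply: le_trans quarter _.
  exact: (simple_walk_success spec zP far t0 k0 tr' rcr crd
    (miss_mass_le reg) weight_le).
- by move=> G; apply: simple_walk_queries.
- apply: le_trans quarter _.
  exact: (fast_walk_success spec zP far t0 k0 tr' rcr crd
    (miss_mass_le reg) weight_le hr).
- by move=> G; apply: fast_walk_queries.
Qed.
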